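(* Consider the nonparametric regression model with random design described in the context, and let conditions C1--C4 stated there be fulfilled with some known values of $g_{\min}$, $\vartheta=2L/\kappa$ and $L_2$. Assume furthermore that the design density $g$ and an upper estimate on the noise magnitude $\sigma$ (denoted again by $\sigma$) are available. Set $$m=(\vartheta d^* )^{1/2},\qquad \lambda=4(\sigma+L_2)\left(\frac{d^*\log(24\sqrt{\vartheta}\,d/d^* )}{n\,g_{\min}^2}\right)^{1/2}.$$ If $$\frac{d^*\log(24\sqrt\vartheta\, d/d^* )}{n}\le\frac{L_2^2}{L_\infty^2}\qquad\text{and}\qquad \frac{128(\sigma+L_2)^2\,d^*\,N(d^*,\vartheta)\log(24\sqrt\vartheta\, d/d^* )}{n\,g_{\min}^2}<\kappa,$$ then the estimator $\widehat J^{(1)}_n(m,\lambda)$ satisfies $$\mathbf P\bigl(\widehat J^{(1)}_n(m,\lambda)\neq J\bigr)\le(8d/d^* )^{-d^*}.$$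
   Context: $n\ge1$ and $1\le d^*\le d$ are integers. Model: one observes $n$ i.i.d. pairs $(\mathbf X_i,Y_i)\in\mathbb R^d\times\mathbb R$ with $Y_i=f(\mathbf X_i)+\sigma\varepsilon_i$ and $\mathbf E[\varepsilon_i|\mathbf X_i]=0$, $i=1,\dots,n$. $P_X$ denotes the distribution of $\mathbf X_i$ and $g$ its density with respect to Lebesgue measure. Fourier basis: for $\mathbf k\in\mathbb Z^d$, $\varphi_{\mathbf 0}\equiv1$, $\varphi_{\mathbf k}(\mathbf x)=\sqrt2\cos(2\pi\mathbf k\cdot\mathbf x)$ if $\mathbf k\in(\mathbb Z^d)_+$ and $\varphi_{\mathbf k}(\mathbf x)=\sqrt2\sin(2\pi\mathbf k\cdot\mathbf x)$ if $-\mathbf k\in(\mathbb Z^d)_+$, where $(\mathbb Z^d)_+$ is the set of $\mathbf k\in\mathbb Z^d\setminus\{0\}$ whose first nonzero coordinate is positive. For $f\in L^2([0,1]^d)$, $\theta_{\mathbf k}[f]=\int_{[0,1]^d}f\varphi_{\mathbf k}$ (Lebesgue measure). Conditions: C1$(\kappa,L)$ ($\kappa>0$, $L<\infty$): $\sum_{\mathbf k\in\mathbb Z^d}k_j^2\theta_{\mathbf k}[f]^2\le L$ for all $j\in\{1,\dots,d\}$; and for some $J\subset\{1,\dots,d\}$ with $\operatorname{Card}(J)\le d^*$ (the sparsity pattern) there is a function $\bar f:\mathbb R^{\operatorname{Card}(J)}\to\mathbb R$ with $f(\mathbf x)=\bar f(\mathbf x_J)$ for all $\mathbf x$ ($\mathbf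 x_J$ being the subvector of coordinates with index in $J$), and $\sum_{\mathbf k:k_j\neq0}\theta_{\mathbf k}[f]^2\ge\kappa$ for all $j\in J$. C2: $g(\mathbf x)=0$ for $\mathbf x\notin[0,1]^d$ and $g(\mathbf x)\ge g_{\min}$ for $\mathbf x\in[0,1]^d$, where $g_{\min}>0$. C3$(L_\infty,L_2)$: $\mathbf P(|f(\mathbf X)|\le L_\infty)=1$ and $\mathbf E[f(\mathbf X)^2]\le L_2^2$, where $\mathbf X\sim P_X$. C4: almost surely $\mathbf E[e^{t\varepsilon_i}|\mathbf X_i]\le e^{t^2/2}$ for all $t>0$. Estimator: $\widehat\theta_{\mathbf k}=\frac1n\sum_{i=1}^n\frac{\varphi_{\mathbf k}(\mathbf X_i)}{g(\mathbf X_i)}Y_i$ for $\mathbf k\in\mathbb Z^d$; $S^j_{m,\ell}=\{\mathbf k\in\mathbb Z^d:\|\mathbf k\|_2\le m,\ \|\mathbf k\|_0\le\ell,\ k_j\neq0\}$, where $\|\mathbf k\|_0$ is the number of nonzero coordinates; and $$\widehat J^{(1)}_n(m,\lambda)=\Bigl\{j\in\{1,\dots,d\}:\max_{\mathbf k\in S^j_{m,d^*}}|\widehat\theta_{\mathbf k}|>\lambda\Bigr\}.$$ For an integer $\ell\ge1$ and $\gamma>0$, $N(\ell,\gamma)=\operatorname{Card}\{\mathbf k\in\mathbb Z^\ell:\|\mathbf k\|_2^2\le\gamma\ell,\ k_1\neq0\}$.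
   Formalization: C4 is assumed for all real t (with t>0 only, heavy lower noise tails break the bound); if J is empty (constant f), κ≤L is also assumed, which C1 implies for nonempty J and without which λ can be 0 or undefined and the claim fails. *)

(* Defs.v *)
From HB Require Import structures.
From mathcomp Require Import all_boot all_order all_algebra finmap.
From mathcomp Require Import all_classical all_reals all_analysis measurable_realfun zify.

Set Implicit Arguments.
Unset Strict Implicit.
Unset Printing Implicit Defensive.

Import Order.TTheory GRing.Theory Num.Theory.
Import numFieldNormedType.Exports.

Local Open Scope classical_set_scope.
Local Open Scope ring_scope.

Section lebesgue_vec_def.
Variable R : realType.

Definition cons_vec (d : nat) (p : measurableTypeR R * d.-tuple R) : d.+1.-tuple R :=
  [tuple of (p.1 : R) :: p.2].

Let measurable_cons_vec d : measurable_fun setT (@cons_vec d).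
Proof. by apply: measurable_cons; [exact: measurable_fst|exact: measurable_snd]. Qed.

Section step.
Variables (d : nat) (mu : {sigma_finite_measure set (d.-tuple R) -> \bar R}).

Definition cons_measure : set (d.+1.-tuple R) -> \bar R :=
  pushforward (@lebesgue_measure R \x mu)%E (@cons_vec d).

Let preimage_cons_vec A : measurable A -> measurable (@cons_vec d @^-1` A).
Proof. by move=> mA; rewrite -[X in measurable X]setTI; exact: measurable_cons_vec. Qed.

Let cons_measure0 : cons_measure set0 = 0%E.
Proof. by rewrite /cons_measure /pushforward preimage_set0 measure0. Qed.

Let cons_measure_ge0 A : (0 <= cons_measure A)%E.
Proof. by rewrite /cons_measure /pushforward; apply: measure_ge0. Qed.

Let cons_measure_sigma_additive : semi_sigma_additive cons_measure.
Proof.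
move=> F mF tF mUF; rewrite /cons_measure /pushforward preimage_bigcup.
apply: measure_semi_sigma_additive.
- by move=> k; exact: preimage_cons_vec.
- apply/trivIsetP => /= i j _ _ ij; rewrite -preimage_setI.
  by move/trivIsetP : tF => /(_ _ _ _ _ ij) ->//; rewrite preimage_set0.
- by rewrite -preimage_bigcup; exact: preimage_cons_vec.
Qed.

HB.instance Definition _ := isMeasure.Build _ _ _ cons_measure
  cons_measure0 cons_measure_ge0 cons_measure_sigma_additive.

Lemma cons_measureX (A : set (measurableTypeR R)) (B : set (d.-tuple R)) :
  measurable A -> measurable B ->
  cons_measure [set x | A (thead x) /\ B [tuple of behead x]] =
  (lebesgue_measure A * mu B)%E.
Proof.
move=> mA mB; rewrite -product_measure1E//= /cons_measure /pushforward.
have consK (x : measurableTypeR R) (y : d.-tuple R) :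
    [tuple of behead (cons_vec (x, y))] = y by exact/val_inj.
by congr (_ _); apply/seteqP; split=> -[x y] [? ?]; split=> //=;
  rewrite ?consK// -(consK x y).
Qed.

Let sigma_finite_cons_measure : sigma_finite setT cons_measure.
Proof.
have /sigma_finiteP[F [TF ndF Foo]] := sigma_finiteT (@lebesgue_measure R).
have /sigma_finiteP[G [TG ndG Goo]] := sigma_finiteT mu.
exists (fun k => [set x | F k (thead x) /\ G k [tuple of behead x]]).
  apply/esym/seteqP; split=> // x _.
  have [i _ Fi] : (\bigcup_k F k) (thead x) by rewrite -TF.
  have [j _ Gj] : (\bigcup_k G k) [tuple of behead x] by rewrite -TG.
  exists (maxn i j) => //; split.
    by move: Fi; exact/subsetPset/ndF/leq_maxl.
  by move: Gj; exact/subsetPset/ndG/leq_maxr.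
move=> k; have [mF Fk] := Foo k; have [mG Gk] := Goo k; split.
  apply: measurableI; rewrite -[X in measurable X]setTI.
    exact: (measurable_tnth ord0).
  exact: measurable_behead.
by rewrite cons_measureX// lte_mul_pinfty// ge0_fin_numE.
Qed.

HB.instance Definition _ := Measure_isSigmaFinite.Build _ _ _ cons_measure
  sigma_finite_cons_measure.

End step.

Fixpoint lebesgue_vec (d : nat) : {sigma_finite_measure set (d.-tuple R) -> \bar R} :=
  match d with
  | 0 => dirac (nil_tuple R)
  | d'.+1 => cons_measure (lebesgue_vec d')
  end.

Lemma lebesgue_vec_box d (A : 'I_d -> set R) :
  (forall i, measurable (A i)) ->
  lebesgue_vec d [set x | forall i, A i (tnth x i)] =
  (\prod_(i < d) lebesgue_measure (A i))%E.
Proof.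
elim: d A => [|d IH] A mA.
  by rewrite big_ord0 /= diracE mem_set// => -[].
rewrite big_ord_recl -IH; last by move=> i; exact: mA.
have mB : measurable [set x : d.-tuple R | forall i, A (lift ord0 i) (tnth x i)].
  rewrite [X in measurable X](_ : _ = \bigcap_(i in [set: 'I_d])
      ((fun x : d.-tuple R => tnth x i) @^-1` A (lift ord0 i))); last first.
    by apply/seteqP; split=> [x h i _|x h i]; exact: h.
  apply: fin_bigcap_measurable => // i _; rewrite -[X in measurable X]setTI.
  by apply: measurable_tnth => //; exact: mA.
rewrite -cons_measureX//=; last exact: mA.
apply: (congr1 (cons_measure (lebesgue_vec d))).
apply/seteqP; split=> x /=.
  move=> h; split; first exact: h.
  by move=> i; have := h (lift ord0 i); rewrite {1}(tuple_eta x) tnthS.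
move=> [h0 h] i; case: (unliftP ord0 i) => [j ->|->//].
by rewrite (tuple_eta x) tnthS; exact: h.
Qed.

End lebesgue_vec_def.

Section probability_notions.
Context {dT : measure_display} {T : measurableType dT} {R : realType}.
Variable P : probability T R.

(* Taking some of the [B i] equal to [setT] gives the product rule for every
   subfamily. *)
Definition mutually_independent (I : finType) (d' : measure_display)
    (T' : measurableType d') (Z : I -> T -> T') : Prop :=
  forall B : I -> set T', (forall i, measurable (B i)) ->
    P (\bigcap_(i in [set: I]) (Z i @^-1` B i)) = (\prod_(i : I) P (Z i @^-1` B i))%E.

Definition identically_distributed (I : Type) (d' : measure_display)
    (T' : measurableType d') (Z : I -> T -> T') : Prop :=
  forall i j (B : set T'), measurable B -> P (Z i @^-1` B) = P (Z j @^-1` B).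

(* [h \o X] is a version of E[Z | X]; to be used for [Z] integrable or
   nonnegative, so that the left-hand integrals are meaningful. *)
Definition is_cond_expectation (d' : measure_display) (T' : measurableType d')
    (Z : T -> \bar R) (X : T -> T') (h : T' -> \bar R) : Prop :=
  measurable_fun setT h /\
  forall B : set T', measurable B ->
    (\int[P]_(w in X @^-1` B) Z w = \int[P]_(w in X @^-1` B) h (X w))%E.

Definition cond_centered (d' : measure_display) (T' : measurableType d')
    (e : T -> R) (X : T -> T') : Prop :=
  P.-integrable setT (EFin \o e) /\
  exists2 h, is_cond_expectation (EFin \o e) X h & {ae P, forall w, h (X w) = 0%E}.

(* The exponent ranges over all of R: with [0 < t] only, the lower tail of the
   noise would be controlled by its variance alone, and the conclusion of the
   selection theorem would fail. *)
Definition cond_subgaussian (d' : measure_display) (T' : measurableType d')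
    (e : T -> R) (X : T -> T') : Prop :=
  exists2 h : R -> T' -> \bar R,
    (forall t, is_cond_expectation (fun w => (expR (t * e w))%:E) X (h t)) &
    {ae P, forall w, forall t : R, (h t (X w) <= (expR (t ^+ 2 / 2))%:E)%E}.

End probability_notions.

Notation freq d := {ffun 'I_d -> int}.

Section frequencies.
Variables (R : realType) (d : nat).
Implicit Types (k : freq d) (j : 'I_d).

Definition l2norm k : R := Num.sqrt (\sum_(j < d) (k j)%:~R ^+ 2).

Definition l0norm k : nat := #|[pred j | k j != 0]|.

Lemma finite_l2ball (r : R) : finite_set [set k : freq d | l2norm k <= r].
Proof.
pose M := (Num.truncn r).+1.
pose shift (a : {ffun 'I_d -> 'I_(M + M).+1}) : freq d := [ffun j => (a j)%:Z - M%:Z].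
apply: (@sub_finite_set _ _ (shift @` setT)); last exact/finite_image/finite_finset.
move=> k /= kr.
have kM j : (`|k j| <= M)%N.
  apply/ltnW; rewrite -(ltr_nat R) natr_absz intr_norm.
  apply: (@le_lt_trans _ _ r); last exact: truncnS_gt.
  apply: le_trans kr; rewrite -sqrtr_sqr ler_wsqrtr// (bigD1 j)//= lerDl.
  by apply: sumr_ge0 => i _; exact: sqr_ge0.
exists [ffun j => inord `|k j + M%:Z|] => //.
apply/ffunP => j; rewrite !ffunE; have := kM j => {kM kr}.
by move: (k j) => z zM; rewrite inordK; lia.
Qed.

(* (Z^d)_+ *)
Definition freq_pos k : bool :=
  [exists j, (0 < k j) && [forall i : 'I_d, (i < j)%N ==> (k i == 0)]].

Definition dotp k (x : d.-tuple R) : R := \sum_(j < d) (k j)%:~R * tnth x j.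

(* For [k != 0], exactly one of [k] and [- k] is in (Z^d)_+. *)
Definition fourier k (x : d.-tuple R) : R :=
  if k == 0 then 1
  else if freq_pos k then Num.sqrt 2 * cos (2 * pi * dotp k x)
  else Num.sqrt 2 * sin (2 * pi * dotp k x).

Definition cube : set (d.-tuple R) := [set x | forall j, 0 <= tnth x j <= 1].

Definition fourier_coef (f : d.-tuple R -> R) k : R :=
  \int[lebesgue_vec R d]_(x in cube) (f x * fourier k x).

Definition freq_set (m : R) (l : nat) j : set (freq d) :=
  [set k | [/\ l2norm k <= m, (l0norm k <= l)%N & k j != 0]].

End frequencies.

(* The first coordinate has index 0; [fset_set] of this finite set is the set
   itself. *)
Definition lattice_count (R : realType) (l : nat) (gamma : R) : nat :=
  #|` fset_set [set k : freq l | l2norm R k ^+ 2 <= gamma * l%:R /\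
        exists2 i : 'I_l, i = 0%N :> nat & k i != 0] |.

Definition subvec (R : realType) (d : nat) (J : {set 'I_d}) (x : d.-tuple R) :
  #|J|.-tuple R := [tuple tnth x (enum_val i) | i < #|J|].

Section conditions.
Variables (R : realType) (d : nat).
Implicit Types (f g : d.-tuple R -> R).

Record C1 (kappa L : R) (dstar : nat) f (J : {set 'I_d}) : Prop := {
  C1_smooth : forall j : 'I_d,
    (\esum_(k in [set: freq d]) ((k j)%:~R ^+ 2 * fourier_coef f k ^+ 2)%:E <= L%:E)%E ;
  C1_card : (#|J| <= dstar)%N ;
  C1_sparse : exists fbar : #|J|.-tuple R -> R, forall x, f x = fbar (subvec J x) ;
  C1_relevant : forall j, j \in J ->
    (kappa%:E <= \esum_(k in [set k : freq d | k j != 0%R]) (fourier_coef f k ^+ 2)%:E)%E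
}.

Record C2 (gmin : R) g : Prop := {
  C2_gmin_gt0 : 0 < gmin ;
  C2_out : forall x, ~ cube x -> g x = 0 ;
  C2_in : forall x, cube x -> gmin <= g x
}.

Record C3 (PX : probability (d.-tuple R) R) (Linf L2 : R) f : Prop := {
  C3_bounded : PX [set x | `|f x| <= Linf] = 1%E ;
  C3_moment : (\int[PX]_x (f x ^+ 2)%:E <= (L2 ^+ 2)%:E)%E
}.

End conditions.

Section model.
Context {dT : measure_display} {T : measurableType dT} {R : realType}.
Variable P : probability T R.
Variables n d : nat.

Record regression_model (PX : probability (d.-tuple R) R)
    (g f : d.-tuple R -> R) (sigma : R)
    (X : 'I_n -> {RV P >-> d.-tuple R}) (Y eps : 'I_n -> {RV P >-> R}) : Prop := {
  model_indep : mutually_independent P (fun i w => (X i w, Y i w)) ;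
  model_ident : identically_distributed P (fun i w => (X i w, Y i w)) ;
  model_eq : forall i w, Y i w = f (X i w) + sigma * eps i w ;
  model_centered : forall i, cond_centered P (eps i) (X i) ;
  model_law : forall i (B : set (d.-tuple R)), measurable B -> P (X i @^-1` B) = PX B ;
  model_measurable_f : measurable_fun setT f ;
  model_measurable_g : measurable_fun setT g ;
  model_density : forall B : set (d.-tuple R), measurable B ->
    (PX B = \int[lebesgue_vec R d]_(x in B) (g x)%:E)%E
}.

Definition C4 (X : 'I_n -> {RV P >-> d.-tuple R}) (eps : 'I_n -> {RV P >-> R}) : Prop :=
  forall i, cond_subgaussian P (eps i) (X i).

End model.

Section estimator.
Variables (R : realType) (n d : nat) (g : d.-tuple R -> R).
Variables (x : 'I_n -> d.-tuple R) (y : 'I_n -> R).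

Definition emp_coef (k : freq d) : R :=
  n%:R^-1 * \sum_(i < n) fourier k (x i) / g (x i) * y i.

(* The maximum of nonnegative numbers over a finite index set; it is 0 when the
   set is empty. *)
Definition Jhat (dstar : nat) (m lambda : R) : {set 'I_d} :=
  [set j : 'I_d | lambda <
     \big[Num.max/0]_(k <- fset_set (freq_set m dstar j)) `|emp_coef k|]%SET.

End estimator.

(* Main.v *)
(* Write s for dstar.  On the event where every empirical coefficient with norm at
   most m and at most s nonzero coordinates is within lambda of its mean theta_k[f],
   the estimator equals J: a coefficient involving an irrelevant variable has mean 0,
   while for each relevant j the frequencies of norm greater than m carry at most
   s L / m^2 = kappa / 2 of the energy, so that one of the at most N(s, theta)
   remaining ones has |theta_k[f]| > 2 lambda.
   Conditioning on the design and using e^x <= 1 + x + x^2 for x <= 3/2, one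
   observation satisfies
     E exp(t (phi_k(X) Y / g(X) - theta_k)) <= exp(2 t^2 (sigma + L2)^2 / gmin^2),
   and Chernoff's bound with t = gmin r / (sigma + L2), r^2 = s lg / n, gives the
   deviation probability 2 exp(- 2 s lg) for each frequency.  There are at most
   (2 e^2 theta d / s)^s frequencies, and e^2 <= 18. *)

Require Import Defs.
From HB Require Import structures.
From mathcomp Require Import all_boot all_order all_algebra finmap.
From mathcomp Require Import all_classical all_reals all_analysis measurable_realfun.
From mathcomp Require Import ring lra zify.

Set Implicit Arguments.
Unset Strict Implicit.
Unset Printing Implicit Defensive.

Import Order.TTheory GRing.Theory Num.Theory.
Import numFieldNormedType.Exports.

Local Open Scope classical_set_scope.
Local Open Scope ring_scope.

(** * Exponential inequalities *)

(** Three hypotheses come in a form that the exponential bounds cannot use directly. Independence is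
    a product rule for events, while Chernoff's bound needs it for expectations of products of
    nonnegative functions. The noise condition concerns E[e^(t eps) | X] with a constant t, while
    here the noise carries the random coefficient t sigma phi_k(X) / g(X). Finally |f| <= Linf holds
    only with design probability one, while theta_k[f] is a Lebesgue integral: the lower bound on g
    over the cube makes the exceptional set Lebesgue-null there, and elsewhere indicators cut the
    functions off.

    The range x <= 3/2 of the quadratic inequality comes from |phi_k / g| <= sqrt 2 / gmin: the
    first assumption on n says r Linf <= L2, so that the bounded part of the exponent is at most
    sqrt 2 in absolute value. The bound Linf serves only for this; the exponent itself involves the
    second moment L2^2. *)

Section exponential.
Variable R : realType.
Implicit Type x : R.

Lemma expR_le_inv x : x < 1 -> expR x <= (1 - x)^-1.
Proof.
move=> x1; rewrite -[expR x]invrK -expRN lef_pV2 ?posrE ?expR_gt0 ?subr_gt0//.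
exact: expR_ge1Dx.
Qed.

(** The constant 18 = 24^2 / 32 is what the final union bound can afford; the sixth power of e^(1/3)
    <= 3/2 gives about 11.4. *)
Lemma expR2_le18 : expR 2 <= 18 :> R.
Proof.
have h : expR 3^-1 <= 3 / 2 :> R.
  have -> : 3 / 2 = (1 - 3^-1)^-1 :> R by field.
  by apply: expR_le_inv; lra.
have -> : 2 = 3^-1 * 6%:R :> R by lra.
rewrite expRM_natr; apply: (@le_trans _ _ ((3 / 2) ^+ 6)).
  by rewrite lerXn2r ?nnegrE ?expR_ge0//; lra.
by rewrite !exprS expr0; lra.
Qed.

(** 19/4 is the value of 1 + x + x^2 at x = 3/2. The true value is about 4.48, so a small step is
    needed: (16/15)^24 is about 4.71. *)
Lemma expR_3half_le : expR (3 / 2) <= 19 / 4 :> R.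
Proof.
have h : expR 16^-1 <= 16 / 15 :> R.
  have -> : 16 / 15 = (1 - 16^-1)^-1 :> R by field.
  by apply: expR_le_inv; lra.
have -> : 3 / 2 = 16^-1 * 24%:R :> R by lra.
rewrite expRM_natr; apply: (@le_trans _ _ ((16 / 15) ^+ 24)).
  by rewrite lerXn2r ?nnegrE ?expR_ge0//; lra.
by rewrite !exprS expr0; lra.
Qed.

(* (1 + x + x^2) e^-x has derivative x (1 - x) e^-x, hence its minimum over
   ]-oo, 3/2] is attained at 0 or at 3/2. *)
Lemma expR_le_quadratic x : x <= 3 / 2 -> expR x <= 1 + x + x ^+ 2.
Proof.
move=> x32.
pose f (y : R) := (1 + y + y ^+ 2) * expR (- y).
pose df (y : R) := y * (1 - y) * expR (- y).
have fdf (y : R) : is_derive y 1 f (df y).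
  apply: is_derive_eq.
  by rewrite /df /GRing.scale /=; ring.
have cf : continuous f.
  by move=> y; apply/differentiable_continuous/derivable1_diffP.
have mvt a b : a <= b -> exists2 c, a <= c <= b & f b - f a = df c * (b - a).
  move=> ab; have [|c cab ->] := @MVT_segment R f df a b ab (fun y _ => fdf y).
    exact: continuous_subspaceT.
  by exists c; rewrite // -in_itv/=.
suff f1 : 1 <= f x.
  rewrite -[leLHS]mul1r -ler_pdivlMr ?expR_gt0//.
  by rewrite -expRN.
have f0 : f 0 = 1 by rewrite /f oppr0 expR0; ring.
have sgdf c : 0 < expR (- c) by exact: expR_gt0.
have [x0|x0] := leP x 0.
  have [c /andP[c1 c2]] := mvt _ _ x0; rewrite f0 /df => h.
  have : 0 <= - c * (1 - c) * expR (- c) * (0 - x).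
    by rewrite !mulr_ge0 ?(ltW (sgdf c))//; lra.
  lra.
have [x1|x1] := leP x 1.
  have [c /andP[c1 c2]] := mvt _ _ (ltW x0); rewrite f0 /df => h.
  have : 0 <= c * (1 - c) * expR (- c) * (x - 0).
    by rewrite !mulr_ge0 ?(ltW (sgdf c))//; lra.
  lra.
have [c /andP[c1 c2]] := mvt _ _ x32; rewrite /df => h.
have h1 : 0 <= c * (c - 1) * expR (- c) * (3 / 2 - x).
  by rewrite !mulr_ge0 ?(ltW (sgdf c))//; lra.
suff : 1 <= f (3 / 2) by lra.
rewrite /f expRN -[_ * _^-1]/(_ / _) ler_pdivlMr ?expR_gt0// mul1r.
by apply: (le_trans expR_3half_le); lra.
Qed.

End exponential.

(** * Independence *)

Lemma lee_prod (R : realDomainType) (I : Type) (r : seq I) (Q : pred I)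
    (a b : I -> \bar R) :
  (forall i, Q i -> 0 <= a i <= b i)%E ->
  (\prod_(i <- r | Q i) a i <= \prod_(i <- r | Q i) b i)%E.
Proof.
move=> ab; suff /andP[] : (0 <= \prod_(i <- r | Q i) a i <=
  \prod_(i <- r | Q i) b i)%E by [].
elim/big_rec2 : _ => [|i x y Qi /andP[y0 yx]]; first by rewrite lee01 lexx.
by have /andP[a0 ai] := ab i Qi; rewrite mule_ge0//= lee_pmul.
Qed.

Section independence.
Context {dT : measure_display} {T : measurableType dT} {R : realType}.
Variable P : probability T R.
Context (I : finType) {d' : measure_display} {T' : measurableType d'}.
Variable Z : I -> T -> T'.
Hypothesis mZ : forall i, measurable_fun setT (Z i).
Hypothesis indepZ : mutually_independent P Z.

Import HBNNSimple.

Let mpre i B : measurable B -> measurable (Z i @^-1` B).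
Proof. by move=> mB; rewrite -[X in measurable X]setTI; exact: mZ. Qed.

(** A product of simple functions expands into a combination of indicators of intersections, one for
    each assignment of values to the indices, and the product rule for events applies to each of
    them. *)
Let indep_nnsfun (s : I -> {nnsfun T' >-> R}) :
  (\int[P]_w (\prod_(i : I) s i (Z i w))%:E =
   \prod_(i : I) \int[P]_w (s i (Z i w))%:E)%E.
Proof.
(* One finite set of values common to all [s i], so that the product of sums distributes over the
   functions from [I] to [r]. *)
pose r : {fset R} := fset_set (\bigcup_(i in [set: I]) range (s i)).
have fr : finite_set (\bigcup_(i in [set: I]) range (s i)).
  by apply: bigcup_finite => // i _; exact: fimfunP.
have rP i x : s i x \in r.
  by rewrite in_fset_set// inE; exists i => //; exists x.
have r0 (v : r) : 0 <= val v.
  have := valP v; rewrite in_fset_set// inE => -[i _ [x _ <-]].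
  exact: fun_ge0.
pose A i (v : r) := Z i @^-1` (s i @^-1` [set val v]).
have mA i v : measurable (A i v) by exact: mpre.
have sE i w : s i (Z i w) = \sum_(v : r) val v * \1_(A i v) w.
  rewrite (bigD1 [` rP i (Z i w)]%fset)//= indicE mem_set// mulr1 big1 ?addr0//.
  move=> v vN; rewrite indicE memNset ?mulr0// => h.
  by move/eqP : vN; apply; apply/val_inj; rewrite /= h.
have int_s i : (\int[P]_w (s i (Z i w))%:E = (\sum_(v : r) val v * fine (P (A i v)))%:E)%E.
  under eq_integral do rewrite sE -sumEFin.
  rewrite ge0_integral_sum//; last 2 first.
    by move=> v; apply/measurable_EFinP; exact: measurable_funM.
    by move=> v w _; rewrite lee_fin mulr_ge0.
  rewrite -sumEFin; apply: eq_bigr => v _.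
  under eq_integral do rewrite EFinM.
  rewrite ge0_integralZl_EFin//; last exact/measurable_EFinP.
  by rewrite integral_indic// setIT EFinM fineK// fin_num_measure.
under eq_bigr do rewrite int_s.
rewrite prodEFin bigA_distr_bigA/= -sumEFin.
under eq_integral => w _.
  rewrite (eq_bigr (fun i => \sum_(v : r) val v * \1_(A i v) w)); last by move=> i _.
  rewrite bigA_distr_bigA/= -sumEFin.
  over.
have indicP (f : {ffun I -> r}) w :
    \prod_(i : I) \1_(A i (f i)) w = \1_(\bigcap_(i in [set: I]) A i (f i)) w :> R.
  rewrite [RHS]indicE; have [h|h] := pselect ((\bigcap_(i in [set: I]) A i (f i)) w).
    by rewrite mem_set// big1// => i _; rewrite indicE mem_set//; exact: h.
  rewrite memNset//.
  have [i hi] : exists i, ~ A i (f i) w.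
    by apply/not_existsP => h'; apply: h => i _; apply: contrapT; exact: h'.
  by rewrite (bigD1 i)//= indicE memNset// mul0r.
have mcap (f : {ffun I -> r}) : measurable (\bigcap_(i in [set: I]) A i (f i)).
  by apply: fin_bigcap_measurable => //.
rewrite ge0_integral_sum//=; last 2 first.
  move=> f; apply/measurable_EFinP; under eq_fun do rewrite big_split/= indicP.
  exact: measurable_funM.
  by move=> f w _; rewrite lee_fin; apply: prodr_ge0 => i _; rewrite mulr_ge0 ?(r0 (f i))// indicE.
apply: eq_bigr => f _.
under eq_integral do rewrite big_split/= indicP EFinM.
rewrite ge0_integralZl_EFin//; last 2 first.
  exact/measurable_EFinP.
  by apply: prodr_ge0 => i _; exact: (r0 (f i)).
rewrite integral_indic// setIT.
rewrite [X in (_ * X)%E](@indepZ (fun i => s i @^-1` [set val (f i)]))//.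
rewrite big_split/= EFinM; congr (_ * _)%E.
rewrite -prodEFin; apply: eq_bigr => i _.
by rewrite fineK// fin_num_measure.
Qed.

(** Monotone convergence on the left only: on the right each factor of the simple approximation is
    bounded by its limit, so no convergence of products of possibly infinite integrals is involved.
    Chernoff's bound uses just this inequality. *)
Lemma indep_integral_prod_le (h : I -> T' -> R) :
  (forall i, measurable_fun setT (h i)) -> (forall i x, 0 <= h i x) ->
  (\int[P]_w (\prod_(i : I) h i (Z i w))%:E <=
   \prod_(i : I) \int[P]_w (h i (Z i w))%:E)%E.
Proof.
move=> mh h0.
have mEh i : measurable_fun setT (EFin \o h i) by exact/measurable_EFinP.
pose s n i := nnsfun_approx measurableT (mEh i) n.
have hE i x : (s n i x)%:E @[n --> \oo] --> (h i x)%:E.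
  by apply: cvg_nnsfun_approx => // y _; rewrite lee_fin.
have cvgR i x : s n i x @[n --> \oo] --> h i x.
  exact: (fine_cvg (hE i x)).
have nds i x : {homo (fun n => s n i x) : m n / (m <= n)%N >-> m <= n}.
  by move=> m n mn; exact/lefP/nd_nnsfun_approx.
have sh n i x : s n i x <= h i x.
  rewrite -(cvg_lim (@Rhausdorff R) (@cvgR i x)).
  apply: (nondecreasing_cvgn_le (nds i x)).
  by apply/cvg_ex; exists (h i x); exact: cvgR.
pose F n w := \prod_(i : I) s n i (Z i w).
have cvgF w : (F n w)%:E @[n --> \oo] --> (\prod_(i : I) h i (Z i w))%:E.
  apply: cvg_EFin; first exact: nearW.
  by apply: cvg_big => [|i _]; [exact: mul_continuous|exact: cvgR].
have F0 n w : 0 <= F n w by apply: prodr_ge0.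
rewrite (eq_integral (fun w => limn (fun n => (F n w)%:E))); last first.
  by move=> w _; apply/esym/cvg_lim.
have mF n : measurable_fun setT (fun w => (F n w)%:E).
  apply/measurable_EFinP; apply: measurable_prod => i _.
  exact: measurableT_comp.
have ndF w : {homo (fun n => (F n w)%:E) : m n / (m <= n)%N >-> (m <= n)%E}.
  by move=> m n mn; rewrite lee_fin ler_prod// => i _; rewrite nds// andbT.
rewrite monotone_convergence//; last by move=> n w _; rewrite lee_fin.
apply: lime_le.
  apply: ereal_nondecreasing_is_cvgn => m n mn.
  by apply: ge0_le_integral => // w _; rewrite ?lee_fin ?F0//; exact: ndF.
apply: nearW => n; rewrite indep_nnsfun.
apply: lee_prod => i _.
rewrite integral_ge0//=; last by move=> w _; rewrite lee_fin.
apply: ge0_le_integral => //.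
- by move=> w _; rewrite lee_fin.
- by apply/measurable_EFinP; exact: measurableT_comp.
- by apply/measurable_EFinP; exact: measurableT_comp.
- by move=> w _; rewrite lee_fin.
Qed.

End independence.

(** * Sub-Gaussian noise with a random coefficient *)

Section conditional_mgf.
Context {dT : measure_display} {T : measurableType dT} {R : realType}.
Variable P : probability T R.
Context {d' : measure_display} {T' : measurableType d'}.
Variables (e : T -> R) (X : T -> T').
Hypothesis me : measurable_fun setT e.
Hypothesis mX : measurable_fun setT X.
Hypothesis He : cond_subgaussian P e X.

Import HBSimple HBNNSimple.

Let mpre B : measurable B -> measurable (X @^-1` B).
Proof. by move=> mB; rewrite -[Y in measurable Y]setTI; exact: mX. Qed.

Lemma subgaussian_mgf_on_preimage t B : measurable B ->
  (\int[P]_(w in X @^-1` B) (expR (t * e w))%:E <=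
   (expR (t ^+ 2 / 2))%:E * P (X @^-1` B))%E.
Proof.
move=> mB; have [h hE hle] := He.
have [mh ->//] := hE t.
have mhX : measurable_fun setT (h t \o X) by exact: measurableT_comp.
(* The version [h t] need not be nonnegative; its positive part satisfies the same almost sure bound
   and falls under monotonicity of nonnegative integrals. *)
apply: (@le_trans _ _ (\int[P]_(w in X @^-1` B) ((h t \o X)^\+ w))%E).
  by rewrite integralE geeDl// oppe_le0 integral_ge0.
rewrite -integral_cst; last exact: mpre.
apply: ae_ge0_le_integral => //.
- exact: mpre.
- exact/measurable_funTS/measurable_funepos.
- by move=> w _; rewrite lee_fin expR_ge0.
- have [N [mN N0 hN]] := hle; exists N; split=> // w nle; apply: hN => /= hw.
  apply: nle => _; rewrite funeposE ge_max; apply/andP; split; first exact: hw.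
  by rewrite lee_fin expR_ge0.
Qed.

(** The values of [G] and [u] cut the space into finitely many preimages under [X]. On each of them
    the coefficient of [e] is a constant of absolute value at most [c], and the bound for constant
    exponents applies. *)
Let mgf_simple (G : {nnsfun T' >-> R}) (u : {sfun T' >-> R}) (k : R -> R) (c : R) :
  (forall v, `|k v| <= c) ->
  (\int[P]_w (G (X w) * expR (k (u (X w)) * e w))%:E <=
   (expR (c ^+ 2 / 2))%:E * \int[P]_w (G (X w))%:E)%E.
Proof.
move=> kc.
pose rG : {fset R} := fset_set (range G).
pose ru : {fset R} := fset_set (range u).
have rGP x : G x \in rG.
  by rewrite in_fset_set ?inE; [exists x|exact: fimfunP].
have ruP x : u x \in ru.
  by rewrite in_fset_set ?inE; [exists x|exact: fimfunP].
have rG0 (v : rG) : 0 <= val v.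
  have := valP v; rewrite in_fset_set; last exact: fimfunP.
  by rewrite inE => -[x _ <-]; exact: fun_ge0.
pose A (p : rG * ru) := X @^-1` (G @^-1` [set val p.1] `&` u @^-1` [set val p.2]).
have mA p : measurable (A p) by apply: mpre; exact: measurableI.
(* [F] may depend on [w]; in the first use it does so through [e w]. *)
have decomp (F : R -> R -> R) w : F (G (X w)) (u (X w)) =
    \sum_(p : rG * ru) F (val p.1) (val p.2) * \1_(A p) w.
  rewrite (bigD1 ([` rGP (X w)], [` ruP (X w)])%fset)//= indicE mem_set// mulr1.
  rewrite big1 ?addr0// => -[v b] /= vbN; rewrite indicE memNset ?mulr0// => -[/= h1 h2].
  by move/eqP : vbN; apply; congr pair; apply/val_inj; rewrite /= ?h1 ?h2.
under eq_integral => w _.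
  rewrite (decomp (fun v b => v * expR (k b * e w))) -sumEFin.
  over.
have mexp b : measurable_fun setT (fun w => expR (k b * e w)).
  by apply: measurableT_comp => //; exact: measurable_funM.
rewrite ge0_integral_sum//; last 2 first.
  move=> p; apply/measurable_EFinP; apply: measurable_funM => //.
  exact: measurable_funM.
  by move=> p w _; rewrite lee_fin !mulr_ge0 ?(rG0 p.1) ?expR_ge0// indicE.
under [in leRHS]eq_integral => w _.
  rewrite (decomp (fun v b => v)) -sumEFin.
  over.
rewrite ge0_integral_sum//; last 2 first.
  by move=> p; apply/measurable_EFinP; apply: measurable_funM.
  by move=> p w _; rewrite lee_fin mulr_ge0 ?(rG0 p.1)// indicE.
rewrite ge0_sume_distrr; last first.
  by move=> p _; apply: integral_ge0 => w _; rewrite lee_fin mulr_ge0 ?(rG0 p.1)// indicE.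
apply: lee_sum => p _.
under eq_integral do rewrite -mulrA EFinM.
rewrite ge0_integralZl_EFin ?(rG0 p.1)//; last first.
  by apply/measurable_EFinP; exact: measurable_funM.
under [in leRHS]eq_integral do rewrite EFinM.
rewrite [in leRHS]ge0_integralZl_EFin ?(rG0 p.1)//; last exact/measurable_EFinP.
rewrite integral_indic// setIT muleCA; apply: lee_wpmul2l; first exact: (rG0 p.1).
rewrite (eq_integral ((fun w => (expR (k (val p.2) * e w))%:E) \_ (A p))); last first.
  by move=> w _; rewrite epatch_indic /= EFinM.
rewrite -integral_mkcond.
apply: le_trans (subgaussian_mgf_on_preimage _ _) _; first exact: measurableI.
apply: lee_wpmul2r => //; rewrite lee_fin ler_expR ler_pM2r//.
rewrite -[leLHS]real_normK ?num_real// lerXn2r ?nnegrE//.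
by apply: le_trans (kc 0).
Qed.

(* The hypothesis bounds E[e^(t e) | X] for fixed t only: approximate s by simple
   functions of X, constant on finitely many cells, and pass to the limit by Fatou. *)
Lemma mgf_random_coef (G s : T' -> R) (c : R) :
  measurable_fun setT G -> measurable_fun setT s ->
  (forall x, 0 <= G x) -> (forall x, `|s x| <= c) ->
  (\int[P]_w (G (X w) * expR (s (X w) * e w))%:E <=
   (expR (c ^+ 2 / 2))%:E * \int[P]_w (G (X w))%:E)%E.
Proof.
move=> mG ms G0 sc.
have mEG : measurable_fun setT (EFin \o G) by exact/measurable_EFinP.
have mEs : measurable_fun setT (EFin \o s) by exact/measurable_EFinP.
pose Gn := nnsfun_approx measurableT mEG.
have GE x : (Gn n x)%:E @[n --> \oo] --> (G x)%:E.
  by apply: cvg_nnsfun_approx => // y _; rewrite lee_fin.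
have GnG n x : Gn n x <= G x.
  rewrite -(cvg_lim (@Rhausdorff R) (fine_cvg (GE x))).
  apply: (@nondecreasing_cvgn_le _ (fun n => Gn n x)).
    by move=> i j ij; exact/lefP/nd_nnsfun_approx.
  by apply/cvg_ex; exists (G x); exact: (fine_cvg (GE x)).
have [u uE] := approximation_sfun measurableT mEs.
have c0 : 0 <= c by apply: le_trans (sc point).
(* The approximants [u n] of [s] need not be bounded by [c]. Truncation to [-c, c] restores the
   bound, and it keeps the limit because it is continuous and fixes the values of [s]. *)
pose k (v : R) := Num.max (- c) (Num.min c v).
have kc v : `|k v| <= c.
  by rewrite ler_norml /k le_max lexx/= ge_max ge_min lexx andbT; lra.
have ks x : k (s x) = s x.
  have := sc x; rewrite ler_norml /k => /andP[h1 h2].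
  by rewrite (min_idPr h2) (max_idPr h1).
have ck : continuous k.
  move=> v; apply: (@continuous_max R R (cst (- c)) (cst c \min id)).
    exact: cvg_cst.
  by apply: (@continuous_min R R (cst c) id); [exact: cvg_cst|exact: cvg_id].
pose F n w := Gn n (X w) * expR (k (u n (X w)) * e w).
have cvgF w : (F n w)%:E @[n --> \oo] --> (G (X w) * expR (s (X w) * e w))%:E.
  apply: cvg_EFin; first exact: nearW.
  apply: cvgM; first exact: (fine_cvg (GE (X w))).
  apply: continuous_cvg; first exact: continuous_expR.
  apply: cvgM; last exact: cvg_cst.
  rewrite -[X in _ --> X]ks; apply: continuous_cvg; first exact: ck.
  exact: (fine_cvg (uE (X w) I)).
rewrite (eq_integral (fun w => limn_einf (fun n => (F n w)%:E))); last first.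
  by move=> w _; apply/esym; have /cvg_limn_einf_sup[] := cvgF w.
have F0 n w : (0 <= (F n w)%:E)%E by rewrite lee_fin mulr_ge0 ?expR_ge0.
apply: le_trans (fatou _ _ _ _) _ => //.
  move=> n; apply/measurable_EFinP; apply: measurable_funM.
    exact: measurableT_comp.
  apply: measurableT_comp => //; apply: measurable_funM => //.
  apply: measurableT_comp; first exact: continuous_measurable_fun.
  exact: measurableT_comp.
rewrite limn_einf_lim; apply: lime_le; first exact: is_cvg_einfs.
apply: nearW => n; apply: (@le_trans _ _ (\int[P]_w (F n w)%:E)%E).
  by apply: ereal_inf_lbound; exists n => /=.
apply: le_trans (mgf_simple _ _ kc) _.
apply: lee_wpmul2l; first by rewrite lee_fin expR_ge0.
apply: ge0_le_integral => //.
- by move=> w _; rewrite lee_fin.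
- by apply/measurable_EFinP; exact: measurableT_comp.
- by apply/measurable_EFinP; exact: measurableT_comp.
- by move=> w _; rewrite lee_fin.
Qed.

End conditional_mgf.

(** * Integration against a density *)

Section density.
Context {d : measure_display} {T : measurableType d} {R : realType}.
Variable mu : {sigma_finite_measure set T -> \bar R}.
Variable nu : probability T R.
Variable g : T -> R.
Hypothesis mg : measurable_fun setT g.
Hypothesis nuE : forall B, measurable B -> (nu B = \int[mu]_(x in B) (g x)%:E)%E.

(** The function [g] and the Radon-Nikodym derivative of [nu] have the same integral over every
    measurable set, hence agree [mu]-almost everywhere; the change of variables known for the
    derivative carries over. *)
Lemma integral_density (f : T -> \bar R) : nu.-integrable setT f ->
  (\int[nu]_x f x = \int[mu]_x (f x * (g x)%:E))%E.
Proof.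
move=> intf.
have numu : nu `<< mu.
  apply/null_content_dominatesP => A mA muA; rewrite nuE//.
  apply: null_set_integral => //; apply/measurable_funTS.
  exact/measurable_EFinP.
rewrite -(Radon_Nikodym_change_of_variables numu)//=.
apply: ae_eq_integral => //.
- apply: emeasurable_funM => //; exact: measurable_int intf.
- by apply: emeasurable_funM => //; [exact: measurable_int intf|exact/measurable_EFinP].
- apply: ae_eqe_mul2l => /=.
  rewrite Radon_NikodymE//=.
  case: cid => /= h [h1 h2 h3].
  apply: integral_ae_eq => //=.
  + exact/measurable_EFinP.
  + by move=> E _ mE; rewrite -h3//= nuE.
Qed.

End density.

(** * Fourier coefficients of sparse functions *)

Section lebesgue_vec_facts.
Variable R : realType.

Lemma periodic_intmul (f : R -> R) (t : R) : periodic f t ->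
  forall (z : int) x, f (x + z%:~R * t) = f x.
Proof.
move=> ft [n|n] x; first by rewrite mulr_natl periodicn.
rewrite -[in RHS](subrK (n.+1%:R * t) x) mulr_natl periodicn//.
by rewrite NegzE mulrNz mulNr mulr_natl.
Qed.

(** The phase [c] has two uses: it turns sines into cosines, and it absorbs the other coordinates of
    the dot product. *)
Lemma integral_cos_period (k : int) (c : R) : k != 0 ->
  (\int[lebesgue_measure]_(x in `[0%R, 1%R]) (cos (2 * pi * (k%:~R * x) + c))%:E = 0)%E.
Proof.
move=> k0.
pose w : R := 2 * pi * k%:~R.
have w0 : w != 0 by rewrite /w !mulf_neq0 ?intr_eq0// gt_eqF// pi_gt0.
pose F (x : R) := w^-1 * sin (w * x + c).
have dF (x : R) : is_derive x 1 F (cos (w * x + c)).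
  by apply: is_derive_eq; rewrite /GRing.scale /=; field.
have cF : continuous F.
  by move=> y; apply/differentiable_continuous/derivable1_diffP.
under eq_integral do rewrite mulrA -/w.
rewrite (@continuous_FTC2 _ _ F)//.
- suff -> : F 1 = F 0 by rewrite -EFinB subrr.
  rewrite /F mulr0 add0r mulr1 (addrC w); congr (_ * _).
  rewrite [X in c + X](_ : _ = k%:~R * (pi *+ 2)); last by rewrite /w; ring.
  exact: (periodic_intmul (@sinD2pi R)).
- apply: continuous_subspaceT => x.
  apply: (@continuous_comp _ _ _ (fun x => w * x + c) cos); last exact: continuous_cos.
  by apply: cvgD; [apply: cvgM; [exact: cvg_cst|exact: cvg_id]|exact: cvg_cst].
- split=> //.
  + exact/cvg_at_right_filter/cF.
  + exact/cvg_at_left_filter/cF.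
- by move=> x _; rewrite derive1E; exact: derive_val.
Qed.

Lemma measurable_cons_vec d : measurable_fun setT (@cons_vec R d).
Proof. by apply: measurable_cons; [exact: measurable_fst|exact: measurable_snd]. Qed.

Lemma measurable_dotp d (k : freq d) : measurable_fun setT (@dotp R d k).
Proof.
by apply: measurable_sum => j; apply: measurable_funM => //; exact: measurable_tnth.
Qed.

Lemma cubeE d : @cube R d = [set x | forall i, `[0, 1]%classic (tnth x i)].
Proof. by apply/seteqP; split=> x /= h i; move: (h i); rewrite in_itv. Qed.

Lemma measurable_cube d : measurable (@cube R d).
Proof.
rewrite (_ : @cube R d = \bigcap_(i in [set: 'I_d])
    ((fun x : d.-tuple R => tnth x i) @^-1` `[0, 1]%classic)); last first.
  by rewrite cubeE; apply/seteqP; split=> [x h i _|x h i]; exact: h.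
apply: fin_bigcap_measurable => // i _; rewrite -[X in measurable X]setTI.
exact: measurable_tnth.
Qed.

Lemma lebesgue_vec_cube d : lebesgue_vec R d (@cube R d) = 1%E.
Proof.
rewrite cubeE (@lebesgue_vec_box R d (fun=> `[0, 1]%classic))// big1// => i _.
by rewrite lebesgue_measure_itv/= lte_fin ltr01 oppr0 adde0.
Qed.

(** Fubini along the recursive construction of [lebesgue_vec]; domination by a multiple of the
    indicator of the cube, of measure 1, gives integrability. Both orders are kept because the
    vanishing inner integral below is sometimes the one over the first coordinate and sometimes the
    one over the rest. *)
Lemma integral_lebesgue_vecS d (F : d.+1.-tuple R -> R) (M : R) :
  measurable_fun setT F -> (forall x, `|F x| <= M * \1_(@cube R d.+1) x) ->
  [/\ (\int[lebesgue_vec R d.+1]_x (F x)%:E =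
    \int[lebesgue_measure]_a \int[lebesgue_vec R d]_y (F (cons_vec (a, y)))%:E)%E &
    (\int[lebesgue_vec R d.+1]_x (F x)%:E =
    \int[lebesgue_vec R d]_y \int[lebesgue_measure]_a (F (cons_vec (a, y)))%:E)%E].
Proof.
move=> mF FM; have mC := @measurable_cube d.+1.
have mcons := @measurable_cons_vec d.
have intF : (@lebesgue_measure R \x lebesgue_vec R d)%E.-integrable setT
    ((EFin \o F) \o @cons_vec R d).
  apply: (@le_integrable _ _ _ _ _ measurableT _
    (fun x => (M * \1_(@cube R d.+1) (cons_vec x))%:E)).
  - by apply/measurable_EFinP; exact: measurableT_comp.
  - by move=> x _; rewrite /= lee_fin (le_trans (FM _))// ler_norm.
  - under eq_fun do rewrite EFinM; apply: integrableZl => //.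
    have mi : measurable_fun setT (fun x => \1_(@cube R d.+1) (cons_vec x) : R).
      exact: measurableT_comp.
    apply/integrableP; split; first exact/measurable_EFinP.
    under eq_integral do rewrite gee0_abs ?lee_fin//.
    rewrite (eq_integral (fun x => (\1_(@cons_vec R d @^-1` @cube R d.+1) x)%:E)) //.
    rewrite integral_indic//; last first.
      by rewrite -[X in measurable X]setTI; exact: mcons.
    rewrite setIT [X in (X < _)%E](_ : _ = 1%E) ?ltry//.
    exact: (@lebesgue_vec_cube d.+1).
have -> : (\int[lebesgue_vec R d.+1]_x (F x)%:E =
    \int[(@lebesgue_measure R \x lebesgue_vec R d)%E]_x (F (cons_vec x))%:E)%E.
  transitivity (\int[pushforward (@lebesgue_measure R \x lebesgue_vec R d)%E
      (@cons_vec R d)]_x (EFin \o F) x)%E.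
    by apply: eq_measure_integral.
  rewrite integral_pushforward//.
  exact/measurable_EFinP.
split.
  by rewrite -(integral12_prod_meas1 intF).
by rewrite -(integral21_prod_meas1 intF).
Qed.

End lebesgue_vec_facts.

(** * Integrating out an irrelevant coordinate *)

Section irrelevant_coordinate.
Variable R : realType.

Lemma tnth_cons_vec0 d (a : R) (y : d.-tuple R) : tnth (cons_vec (a, y)) ord0 = a.
Proof. by []. Qed.

Lemma tnth_cons_vecS d (a : R) (y : d.-tuple R) (i : 'I_d) :
  tnth (cons_vec (a, y)) (lift ord0 i) = tnth y i.
Proof. by rewrite tnthS. Qed.

Lemma dotp_cons_vec d (k : freq d.+1) (a : R) (y : d.-tuple R) :
  dotp k (cons_vec (a, y)) =
  (k ord0)%:~R * a + dotp [ffun i => k (lift ord0 i)] y.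
Proof.
rewrite /dotp big_ord_recl tnth_cons_vec0; congr (_ + _).
by apply: eq_bigr => i _; rewrite tnth_cons_vecS ffunE.
Qed.

Lemma indic_cube_cons_vec d (a : R) (y : d.-tuple R) :
  \1_(@cube R d.+1) (cons_vec (a, y)) =
  \1_(`[0, 1]%classic) a * \1_(@cube R d) y :> R.
Proof.
rewrite !indicE -natrM mulnb; congr (nat_of_bool _)%:R.
apply/idP/idP => [|/andP[]]; rewrite !inE /=.
  move=> h; apply/andP; split; rewrite !inE /=.
    by have := h ord0; rewrite tnth_cons_vec0 in_itv.
  by move=> i; have := h (lift ord0 i); rewrite tnth_cons_vecS.
rewrite in_itv /= => h0 h i; case: (unliftP ord0 i) => [j ->|->].
  by rewrite tnth_cons_vecS.
by rewrite tnth_cons_vec0.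
Qed.

(** Along coordinate [j] the function [f] is constant and the cosine runs through |k_j| >= 1 full
    periods. Induction on [d] peels off leading coordinates until [j] comes first; each peeled
    coordinate is frozen and moved into the phase, which is why [c] is generalized. *)
Lemma integral_cos_indep_coord d (f : d.-tuple R -> R) (M : R) (j : 'I_d)
    (k : freq d) (c : R) :
  measurable_fun setT f -> (forall x, `|f x| <= M) ->
  (forall x y, (forall i, i != j -> tnth x i = tnth y i) -> f x = f y) ->
  k j != 0 ->
  (\int[lebesgue_vec R d]_x
    (f x * cos (2 * pi * dotp k x + c) * \1_(@cube R d) x)%:E = 0)%E.
Proof.
elim: d f M j k c => [|d IH] f M j k c mf fM fj kj; first by case: j fj kj => [].
have mcos : measurable_fun setT (fun x : d.+1.-tuple R => cos (2 * pi * dotp k x + c)).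
  apply: measurableT_comp; first exact: (continuous_measurable_fun (@continuous_cos R)).
  by apply: measurable_funD => //; apply: measurable_funM => //; exact: measurable_dotp.
have mF : measurable_fun setT (fun x =>
    f x * cos (2 * pi * dotp k x + c) * \1_(@cube R d.+1) x).
  apply: measurable_funM; first exact: measurable_funM.
  by apply: measurable_indic; exact: (@measurable_cube R d.+1).
have FM x : `|f x * cos (2 * pi * dotp k x + c) * \1_(@cube R d.+1) x| <=
    M * \1_(@cube R d.+1) x.
  rewrite !normrM [X in _ * X]ger0_norm// ler_wpM2r//.
  by rewrite -[leRHS]mulr1 ler_pM// cos_max.
have [E12 E21] := integral_lebesgue_vecS mF FM.
case: (unliftP ord0 j) => [j' jE|jE].
- rewrite E12; apply: integral0_eq => a _.
  pose f' y := f (cons_vec (a, y)) * \1_(`[0, 1]%classic) a.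
  rewrite -[RHS](IH f' M j' [ffun i => k (lift ord0 i)] (2 * pi * ((k ord0)%:~R * a) + c)).
  + apply: eq_integral => y _; congr EFin.
    rewrite dotp_cons_vec indic_cube_cons_vec /f' mulrDr.
    by rewrite -!mulrA [cos _ * (_ * _)]mulrCA (addrC (2 * _)) addrA.
  + apply: measurable_funM => //; apply: measurableT_comp => //.
    apply: measurableT_comp; first exact: measurable_cons_vec.
    exact: pair1_measurable.
  + move=> y; rewrite /f' normrM -[leRHS]mulr1 ler_pM// indicE.
    by case: (_ \in _); rewrite ?normr1 ?normr0.
  + move=> x y xy; congr (_ * _); apply: fj => i ij.
    case: (unliftP ord0 i) ij => [i' ->|->]; last by rewrite !tnth_cons_vec0.
    by rewrite jE => ij; rewrite !tnth_cons_vecS xy//; apply: contra_neq ij => ->.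
  + by rewrite ffunE -jE.
- rewrite E21; apply: integral0_eq => y _.
  (* Here [f] ignores the first coordinate, so 0 may stand in its place and [K] does not depend on
     the integration variable. *)
  pose K := f (cons_vec (0, y)) * \1_(@cube R d) y.
  pose c' := 2 * pi * dotp [ffun i => k (lift ord0 i)] y + c.
  pose G (a : R) := cos (2 * pi * ((k ord0)%:~R * a) + c').
  have mG : measurable_fun setT G.
    apply: measurableT_comp; first exact: (continuous_measurable_fun (@continuous_cos R)).
    by apply: measurable_funD => //; apply: measurable_funM => //; exact: measurable_funM.
  transitivity (\int[lebesgue_measure]_(a in `[0%R, 1%R]) (K%:E * (G a)%:E))%E.
    rewrite [RHS]integral_mkcond; apply: eq_integral => a _.
    rewrite epatch_indic /= -!EFinM; congr EFin.
    rewrite dotp_cons_vec indic_cube_cons_vec /K /G /c'.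
    rewrite (fj (cons_vec (a, y)) (cons_vec (0, y))).
      by rewrite mulrDr -addrA; ring.
    move=> i; rewrite jE; case: (unliftP ord0 i) => [i' -> _|-> /eqP//].
    by rewrite !tnth_cons_vecS.
  rewrite integralZl//; last first.
    apply: measurable_bounded_integrable => //.
    + by rewrite /= lebesgue_measure_itv/= lte_fin ltr01 -EFinB ltry.
    + exact: measurable_funTS.
    + by exists 1; split => // x x1 z _ /=; rewrite (le_trans (cos_max _))// ltW.
  by rewrite /G integral_cos_period ?mule0// -jE.
Qed.

End irrelevant_coordinate.

Section fourier_facts.
Variables (R : realType) (d : nat).
Implicit Types (k : freq d) (f g : d.-tuple R -> R).

Lemma fourier_cosE k : k != 0 ->
  exists c, forall x : d.-tuple R, fourier k x = Num.sqrt 2 * cos (2 * pi * dotp k x + c).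
Proof.
move=> k0; rewrite /fourier (negbTE k0); case: (boolP (freq_pos k)) => _.
  by exists 0 => x; rewrite addr0.
exists (- (pi / 2)) => x.
by rewrite cosBpihalf.
Qed.

Lemma measurable_cos_dotp k c :
  measurable_fun setT (fun x : d.-tuple R => cos (2 * pi * dotp k x + c)).
Proof.
apply: measurableT_comp; first exact: (continuous_measurable_fun (@continuous_cos R)).
by apply: measurable_funD => //; apply: measurable_funM => //; exact: measurable_dotp.
Qed.

Lemma measurable_fourier k : measurable_fun setT (@fourier R d k).
Proof.
have [->|/fourier_cosE[c kc]] := eqVneq k 0.
  rewrite (_ : fourier 0 = cst 1); first exact: measurable_cst.
  by apply/funext => x; rewrite /fourier eqxx.
rewrite (_ : fourier k = fun x => Num.sqrt 2 * cos (2 * pi * dotp k x + c)); last exact/funext.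
by apply: measurable_funM => //; exact: measurable_cos_dotp.
Qed.

Lemma normr_fourier_le k (x : d.-tuple R) : `|fourier k x| <= Num.sqrt 2.
Proof.
have [->|/fourier_cosE[c ->]] := eqVneq k 0.
  by rewrite /fourier eqxx normr1 -[leLHS]sqrtr1 ler_wsqrtr// ler1n.
by rewrite normrM ger0_norm ?sqrtr_ge0// ler_piMr ?sqrtr_ge0// cos_max.
Qed.

Lemma fourier_coef_indep_coord f (M : R) (j : 'I_d) k :
  measurable_fun setT f ->
  {ae lebesgue_vec R d, forall x, cube x -> `|f x| <= M} ->
  (forall x y, (forall i, i != j -> tnth x i = tnth y i) -> f x = f y) ->
  k j != 0 -> fourier_coef f k = 0.
Proof.
move=> mf fM fj kj.
have [|c kc] := @fourier_cosE k.
  by apply: contra_neq kj => ->; rewrite ffunE.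
(* The bound on [f] holds only almost everywhere. Cutting off according to the value of [f], and not
   on a set of points, preserves independence of coordinate [j]. *)
pose f' x := Num.sqrt 2 * (f x * \1_[set y | `|y| <= `|M|] (f x)).
have mM : measurable [set y : R | `|y| <= `|M|].
  rewrite (_ : [set _ | _] = Num.norm @^-1` `]-oo, `|M|]%classic); last first.
    by apply/seteqP; split=> y /=; rewrite in_itv.
  by rewrite -[X in measurable X]setTI; exact: normr_measurable.
have mf' : measurable_fun setT f'.
  apply: measurable_funM => //; apply: measurable_funM => //.
  by apply: measurableT_comp => //; exact: measurable_indic.
have f'M x : `|f' x| <= Num.sqrt 2 * `|M|.
  rewrite /f' normrM [ `|Num.sqrt 2|]ger0_norm ?sqrtr_ge0// ler_wpM2l ?sqrtr_ge0//.
  rewrite indicE; have [|_] := boolP (_ \in _); last by rewrite mulr0 normr0.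
  by rewrite inE mulr1.
have f'j x y : (forall i, i != j -> tnth x i = tnth y i) -> f' x = f' y.
  by move=> /fj xy; rewrite /f' xy.
have I0 := integral_cos_indep_coord c mf' f'M f'j kj.
rewrite /fourier_coef /Rintegral; suff -> : (\int[lebesgue_vec R d]_(x in @cube R d)
    (f x * fourier k x)%:E = 0)%E by [].
rewrite -[RHS]I0.
have mC := @measurable_cube R d.
transitivity (\int[lebesgue_vec R d]_(x in @cube R d)
    (f' x * cos (2 * pi * dotp k x + c))%:E)%E.
  apply: ae_eq_integral => //.
  - by apply/measurable_funTS/measurable_EFinP/measurable_funM => //; exact: measurable_fourier.
  - by apply/measurable_funTS/measurable_EFinP/measurable_funM => //; exact: measurable_cos_dotp.
  - apply: filterS fM => x fM Cx; congr EFin.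
    rewrite /f' indicE mem_set/= ?kc; last by rewrite (le_trans (fM Cx))// ler_norm.
    by ring.
rewrite integral_mkcond; apply: eq_integral => x _.
by rewrite epatch_indic /= -EFinM.
Qed.

End fourier_facts.

(** * Counting frequencies *)

Section counting.
Variable R : realType.

(** The whole series is 1 / (e^(1/theta) - 1) <= theta. The induction carries the sharper bound
    theta (1 - q^B), which reduces each step to q <= theta (1 - q). *)
Lemma geometric_sum_le (theta : R) (B : nat) : 0 < theta ->
  \sum_(a < B) expR (- theta^-1) ^+ a.+1 <= theta.
Proof.
move=> th0; set q := expR _.
have q0 : 0 <= q by exact: expR_ge0.
have qth : q <= theta * (1 - q).
  have : q <= theta / (theta + 1).
    have -> : theta / (theta + 1) = (1 - (- theta^-1))^-1.
      by rewrite opprK; field; rewrite !gt_eqF//; lra.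
    by apply: expR_le_inv; rewrite ltrNl (lt_trans _ (_ : 0 < theta^-1)) ?invr_gt0//; lra.
  by rewrite ler_pdivlMr; lra.
suff : \sum_(a < B) q ^+ a.+1 <= theta * (1 - q ^+ B).
  by move=> /le_trans; apply; rewrite ler_piMr ?(ltW th0)// gerBl exprn_ge0.
elim: B => [|B IH]; first by rewrite big_ord0 expr0 subrr mulr0.
rewrite big_ord_recr/=; apply: (le_trans (lerD IH (lexx _))).
have := ler_wpM2r (exprn_ge0 B q0) qth; rewrite -exprS.
by rewrite [q ^+ B.+1]exprS; lra.
Qed.

Lemma sumr_injective_le (I J : finType) (h : I -> J) (w : J -> R) :
  injective h -> (forall j, 0 <= w j) -> \sum_(i : I) w (h i) <= \sum_(j : J) w j.
Proof.
move=> hinj w0.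
rewrite -(big_imset (A := predT) w (in2W hinj)).
rewrite [leRHS](bigID (mem (imset h (mem predT))))/= lerDl; exact: sumr_ge0.
Qed.

(** Zero is kept apart from the nonzero magnitudes 1, ..., B + 1 with a sign, so that a weighted sum
    splits into the term at 0 and twice a geometric sum, with no integer counted twice. *)
Definition signed_nat (B : nat) (u : unit + 'I_B.+1 * bool) : int :=
  match u with
  | inl _ => 0
  | inr (a, b) => (if b then -1 else 1) * a.+1%:Z
  end.

Definition encode_int (B : nat) (z : int) : unit + 'I_B.+1 * bool :=
  if z == 0 then inl tt else inr (inord `|z|.-1, z < 0).

Lemma absz_signed_nat (B : nat) (a : 'I_B.+1) (b : bool) :
  `|signed_nat (inr (a, b))|%N = a.+1.
Proof. by rewrite /=; case: b; rewrite ?mulN1r ?mul1r ?abszN. Qed.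

Lemma encode_intK (B : nat) (z : int) : (`|z| <= B.+1)%N ->
  signed_nat (encode_int B z) = z.
Proof.
move=> zB; rewrite /encode_int; case: eqP => [->//|z0] /=.
by rewrite inordK; [case: ifP|]; lia.
Qed.

(** A finite [K] lies in some box, and the sum over a box of a product of coordinate weights
    factorizes. The bound [W] is uniform in [B] because the box depends on [K]. *)
Lemma sum_weight_freq_le (d : nat) (w : int -> R) (W : R) (K : {fset freq d}) :
  (forall z, 0 <= w z) ->
  (forall B, \sum_(u : unit + 'I_B.+1 * bool) w (signed_nat u) <= W) ->
  \sum_(k : K) \prod_(j < d) w (val k j) <= W ^+ d.
Proof.
move=> w0 wW.
pose B := (\max_(k : K) \max_(j < d) `|val k j|)%N.
have kB (k : K) j : (`|val k j| <= B.+1)%N.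
  apply/leqW; apply: leq_trans (leq_bigmax (F := fun k : K => \max_(j < d) `|val k j|)%N k).
  exact: (leq_bigmax (F := fun j : 'I_d => `|val k j|%N) j).
pose code (k : K) : {ffun 'I_d -> unit + 'I_B.+1 * bool} :=
  [ffun j => encode_int B (val k j)].
have codeK (k : K) j : signed_nat (code k j) = val k j.
  by rewrite ffunE encode_intK.
have code_inj : injective code.
  move=> k k' kk'; apply/val_inj/ffunP => j.
  by rewrite -(codeK k) -(codeK k') kk'.
under eq_bigr => k _ do under eq_bigr => j _ do rewrite -codeK.
pose Wf (f : {ffun 'I_d -> unit + 'I_B.+1 * bool}) := \prod_j w (signed_nat (f j)).
have Wf0 f : 0 <= Wf f by apply: prodr_ge0.
apply: le_trans (sumr_injective_le code_inj Wf0) _; rewrite /Wf.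
rewrite -(bigA_distr_bigA (fun _ u => w (signed_nat u))).
rewrite prodr_const card_ord lerXn2r ?nnegrE// ?sumr_ge0//.
by apply: le_trans (wW 0%N); apply: sumr_ge0.
Qed.

(* Each k in K has weight q^|k|_1 y^-|k|_0 >= (e y)^-s for q = e^(-1/theta) and
   y = 2 theta d / s, since |k|_1 <= |k|_2^2; the weights of all of Z^d sum to at
   most (1 + 2 theta / y)^d <= e^s. *)
Lemma card_sparse_ball_le (d s : nat) (theta : R) (K : {fset freq d}) :
  (1 <= s <= d)%N -> 1 <= theta ->
  (forall k, k \in K -> l2norm R k ^+ 2 <= theta * s%:R /\ (l0norm k <= s)%N) ->
  #|` K|%:R <= (expR 2 * (2 * theta * d%:R / s%:R)) ^+ s.
Proof.
move=> /andP[s1 sd] th1 KP.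
have s0 : 0 < s%:R :> R by rewrite ltr0n.
have th0 : 0 < theta by lra.
have ds : 1 <= d%:R / s%:R :> R by rewrite ler_pdivlMr// mul1r ler_nat.
pose y := 2 * theta * d%:R / s%:R.
have y1 : 1 <= y by rewrite /y -!mulrA; nra.
have y0 : 0 < y by lra.
pose q := expR (- theta^-1).
have q0 : 0 < q by exact: expR_gt0.
pose w (z : int) := q ^+ `|z|%N * (if z == 0 then 1 else y^-1).
have w0 z : 0 <= w z.
  by rewrite mulr_ge0 ?exprn_ge0 ?(ltW q0)//; case: ifP => // _; rewrite invr_ge0 ltW.
have wle B : \sum_(u : unit + 'I_B.+1 * bool) w (signed_nat u) <= 1 + s%:R / d%:R.
  rewrite big_sumType/= (big_pred1 tt)/=; last by case.
  rewrite {1}/w /= expr0 mulr1 lerD2l.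
  rewrite (eq_bigr (fun p => w (signed_nat (inr (p.1, p.2))))); last by case.
  rewrite -(pair_bigA _ (fun a b => w (signed_nat (inr (a, b)))))/=.
  rewrite (eq_bigr (fun a : 'I_B.+1 => q ^+ a.+1 * (y^-1 *+ 2))); last first.
    have wE (a : 'I_B.+1) (b : bool) : w (signed_nat (inr (a, b))) = q ^+ a.+1 * y^-1.
      by rewrite /w -absz_eq0 absz_signed_nat.
    move=> a _; rewrite big_bool mulr2n mulrDr.
    by congr (_ + _); [exact: (wE a true)|exact: (wE a false)].
  rewrite -mulr_suml; apply: (@le_trans _ _ (theta * (y^-1 *+ 2))).
    by rewrite ler_wpM2r ?geometric_sum_le// mulrn_wge0// invr_ge0 ltW.
  rewrite /y -mulr_natr le_eqVlt; apply/orP; left; apply/eqP; field.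
  by rewrite !gt_eqF// ltr0n (leq_trans s1).
have Wd : (1 + s%:R / d%:R) ^+ d <= expR 1 ^+ s :> R.
  apply: (@le_trans _ _ (expR (s%:R / d%:R) ^+ d)).
    by apply: lerXn2r; rewrite ?nnegrE ?expR_ge0 ?expR_ge1Dx ?addr_ge0 ?divr_ge0.
  rewrite -!expRM_natr mul1r divfK// pnatr_eq0 -lt0n.
  exact: leq_trans sd.
have wge (k : K) : (expR 1 * y) ^- s <= \prod_(j < d) w (val k j).
  have [k2 kl0] := KP _ (valP k).
  rewrite big_split/= prodrXr.
  rewrite exprMn invfM ler_pM ?invr_ge0 ?exprn_ge0 ?expR_ge0 ?(ltW y0)//.
    rewrite -!expRM_natr -expRN ler_expR mul1r mulNr lerN2 mulrC ler_pdivrMr// mulrC.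
    apply: le_trans k2; rewrite sqr_sqrtr; last by apply: sumr_ge0 => j _; exact: sqr_ge0.
    rewrite natr_sum; apply: ler_sum => j _.
    rewrite natr_absz -real_normK ?num_real// -intr_norm -rmorphXn /=.
    by rewrite ler_int; nia.
  rewrite -exprVn (eq_bigr (fun j => if val k j != 0 then y^-1 else 1)); last first.
    by move=> j _; case: eqP.
  rewrite -big_mkcond/= prodr_const -/(l0norm (val k)).
  by rewrite ler_wiXn2l ?invr_ge0 ?(ltW y0)// invf_le1.
have := sum_weight_freq_le K w0 wle => /le_trans /(_ Wd) h.
have : #|` K|%:R * (expR 1 * y) ^- s <= expR 1 ^+ s.
  apply: le_trans h; rewrite mulr_natl cardfE -sumr_const; exact: ler_sum.
rewrite ler_pdivrMr; last by rewrite exprn_gt0// mulr_gt0// expR_gt0.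
by rewrite -exprMn (mulrA (expR 1)) -expRD (_ : 1 + 1 = 2).
Qed.

End counting.

(** * A large coefficient for each relevant variable *)

Section large_coefficient.
Variable R : realType.

Lemma sqr_l2norm d (k : freq d) : l2norm R k ^+ 2 = \sum_(j < d) (k j)%:~R ^+ 2.
Proof. by rewrite sqr_sqrtr// sumr_ge0// => j _; exact: sqr_ge0. Qed.

Lemma l2norm_le_sqrt d (k : freq d) (r : R) : 0 <= r ->
  (l2norm R k <= Num.sqrt r) = (l2norm R k ^+ 2 <= r).
Proof.
by move=> r0; rewrite -{2}(sqr_sqrtr r0) ler_sqr ?nnegrE ?sqrtr_ge0.
Qed.

(** List [J] with [j] in front, read [k] along the list and pad with zeros to length [s]. This map
    is injective on frequencies supported in [J], does not increase the norm, and puts k_j in the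
    first place, where [lattice_count] asks for a nonzero entry. *)
Lemma card_supported_le (d s : nat) (J : {set 'I_d}) (j : 'I_d) (theta : R)
    (K : {fset freq d}) :
  j \in J -> (#|J| <= s)%N -> 0 <= theta ->
  (forall k, k \in K ->
    [/\ k j != 0, forall i, i \notin J -> k i = 0 & l2norm R k ^+ 2 <= theta * s%:R]) ->
  (#|` K| <= lattice_count s theta)%N.
Proof.
move=> jJ Js th0 KP.
pose sq := j :: enum (J :\ j)%SET.
have usq : uniq sq by rewrite /= mem_enum !inE eqxx enum_uniq.
have szq : size sq = #|J| by rewrite /= -cardE [RHS](cardsD1 j) jJ.
have szs : (size sq <= s)%N by rewrite szq.
have memsq i : (i \in sq) = (i \in J).
  by rewrite in_cons mem_enum !inE; case: eqVneq => [->|]//=; rewrite jJ.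
pose e (k : freq d) : freq s :=
  [ffun a : 'I_s => if (a < size sq)%N then k (nth j sq a) else 0].
have einj : {in K &, injective e}.
  move=> k k' /KP[_ kJ _] /KP[_ k'J _] ee; apply/ffunP => i.
  have [iJ|iJ] := boolP (i \in J); last by rewrite kJ// k'J.
  have isq : (index i sq < s)%N by rewrite (leq_trans _ szs)// index_mem memsq.
  have := congr1 (fun f : freq s => f (Ordinal isq)) ee.
  by rewrite !ffunE index_mem memsq iJ nth_index ?memsq.
have el2 k : l2norm R (e k) ^+ 2 <= l2norm R k ^+ 2.
  rewrite !sqr_l2norm.
  rewrite (eq_bigr (fun a : 'I_s => if (a < size sq)%N then (k (nth j sq a))%:~R ^+ 2 else 0)).
    have E : \sum_(i <- sq) ((k i)%:~R ^+ 2 : R) =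
        \sum_(a < s | (a < size sq)%N) (k (nth j sq a))%:~R ^+ 2.
      by rewrite (big_nth j) big_mkord (big_ord_widen s (fun a => (k (nth j sq a))%:~R ^+ 2)).
    rewrite -big_mkcond/= -E big_uniq//=.
    by rewrite [leRHS](bigID (mem sq))/= lerDl sumr_ge0// => i _; exact: sqr_ge0.
  by move=> a _; rewrite ffunE; case: ifP => // _; rewrite expr0n.
have <- : #|` [fset e k | k in K]%fset| = #|` K|.
  by rewrite card_in_imfset//= -fsetE.
apply: fsubset_leq_card.
apply/fsubsetP => _ /imfsetP[k /= kK ->].
have [kj kJ k2] := KP k kK.
rewrite in_fset_set; last first.
  apply: (sub_finite_set _ (@finite_l2ball R s (Num.sqrt (theta * s%:R)))) => k' /= [k'2 _].
  by rewrite l2norm_le_sqrt// mulr_ge0.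
rewrite inE /=; split; first exact: le_trans k2.
have s0 : (0 < s)%N by apply: leq_trans szs.
by exists (Ordinal s0) => //; rewrite ffunE.
Qed.

Lemma sum_fset_le_esum (I : choiceType) (S : set I) (a : I -> R) (K : {fset I}) :
  (forall k, k \in K -> S k) ->
  ((\sum_(k <- K) a k)%:E <= \esum_(k in S) (a k)%:E)%E.
Proof.
move=> KS; apply: esum_ge; exists [set` K].
  by split => [|k /= /KS].
by rewrite fsbig_finite// set_fsetK -sumEFin.
Qed.

Lemma esum_le_sum_fset (I : choiceType) (S : set I) (a : I -> R) (B : R) :
  (forall K : {fset I}, (forall k, k \in K -> S k) -> \sum_(k <- K) a k <= B) ->
  (\esum_(k in S) (a k)%:E <= B%:E)%E.
Proof.
move=> KB; apply: ge_ereal_sup => _ [A [finA AS] <-].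
rewrite fsbig_finite//= sumEFin lee_fin; apply: KB => k.
by rewrite in_fset_set// inE => /AS.
Qed.

Section sparse_coefficients.
Variables (d s : nat) (a : freq d -> R) (J : {set 'I_d}) (kappa L : R).
Let theta := 2 * L / kappa.
Hypotheses (kappa0 : 0 < kappa) (s0 : (0 < s)%N) (Js : (#|J| <= s)%N).
Hypothesis smooth : forall i : 'I_d,
  (\esum_(k in [set: freq d]) ((k i)%:~R ^+ 2 * a k ^+ 2)%:E <= L%:E)%E.
Variable j : 'I_d.
Hypothesis relevant :
  (kappa%:E <= \esum_(k in [set k : freq d | k j != 0%R]) (a k ^+ 2)%:E)%E.

(** A nonzero integer has square at least 1, so the smoothness sum for [j] dominates the relevance
    sum. *)
Lemma kappa_le_smoothness : kappa <= L.
Proof.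
clear kappa0 s0 Js.
rewrite -lee_fin; apply: le_trans (smooth j); apply: le_trans relevant _.
rewrite [leLHS]esum_mkcond; apply: le_esum => k _.
case: ifPn => [|_]; last by rewrite lee_fin mulr_ge0// sqr_ge0.
rewrite inE /= => kj; rewrite lee_fin ler_peMl ?sqr_ge0//.
rewrite -rmorphXn ler1z; nia.
Qed.

Lemma exists_large_coef (l : R) : j \in J ->
  (forall (k : freq d) i, i \notin J -> k i != 0 -> a k = 0) ->
  2 * (lattice_count s theta)%:R * l ^+ 2 < kappa ->
  exists k, freq_set (Num.sqrt (theta * s%:R)) s j k /\ l < `|a k|.
Proof.
move=> jJ aJ lk; apply: contrapT => /forallNP noK.
have kL := kappa_le_smoothness.
have L0 : 0 < L by exact: lt_le_trans kL.
have th0 : 0 < theta by rewrite divr_gt0// mulr_gt0.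
have ths : 0 < theta * s%:R by rewrite mulr_gt0// ltr0n.
(* By [lk] the first summand is strictly below kappa / 2, so this bound contradicts relevance of
   [j]. *)
suff : (\esum_(k in [set k : freq d | k j != 0%R]) (a k ^+ 2)%:E <=
    ((lattice_count s theta)%:R * l ^+ 2 + kappa / 2)%:E)%E.
  by move=> /(le_trans relevant); rewrite lee_fin; lra.
apply: esum_le_sum_fset => K Kj.
pose good (k : freq d) := [forall i, (i \notin J) ==> (k i == 0)] &&
   (l2norm R k ^+ 2 <= theta * s%:R).
pose K1 := [fset k in K | good k]%fset.
have K1N : (#|` K1| <= lattice_count s theta)%N.
  apply: (card_supported_le jJ Js (ltW th0)) => k.
  rewrite !inE /= => /andP[kK /andP[/forallP kJ k2]]; split => //; first exact: Kj.
  by move=> i iJ; have := kJ i; rewrite iJ => /eqP.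
have small k : k \in K1 -> a k ^+ 2 <= l ^+ 2.
  rewrite !inE /= => /andP[kK /andP[/forallP kJ k2]].
  have kS : freq_set (Num.sqrt (theta * s%:R)) s j k.
    split; last exact: Kj.
      by rewrite l2norm_le_sqrt// ltW.
    apply: leq_trans Js; apply: subset_leq_card; apply/fintype.subsetP => i.
    by rewrite inE; apply: contraR => iJ; have := kJ i; rewrite iJ.
  have : ~ l < `|a k| by move=> lak; apply: (noK k).
  move/negP; rewrite -leNgt => akl.
  by rewrite -[leLHS]real_normK ?num_real// lerXn2r ?nnegrE// (le_trans _ akl).
(* A Chebyshev-type bound. Outside the good frequencies, either some entry outside [J] is nonzero
   and the coefficient vanishes, or the norm is too large; with a nonzero coefficient the sum of
   k_i^2 over [J] then exceeds theta s, and the second term suffices. *)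
have pointwise k : k \in K -> a k ^+ 2 <= (if good k then l ^+ 2 else 0) +
    (theta * s%:R)^-1 * \sum_(i in J) (k i)%:~R ^+ 2 * a k ^+ 2.
  move=> kK; have sum0 : 0 <= \sum_(i in J) (k i)%:~R ^+ 2 * a k ^+ 2.
    by apply: sumr_ge0 => i _; rewrite mulr_ge0// sqr_ge0.
  case: ifPn => [kgood|].
    apply: (le_trans (small k _)); first by rewrite !inE kK.
    by rewrite lerDl mulr_ge0// invr_ge0 ltW.
  rewrite negb_and add0r => /orP[|k2].
    rewrite negb_forall => /existsP[i]; rewrite negb_imply => /andP[iJ ki].
    by rewrite (aJ k i)// expr0n/= mulr_ge0// ?invr_ge0 ?(ltW ths)// sumr_ge0.
  have [->|] := eqVneq (a k) 0.
    by rewrite expr0n/= mulr_ge0// ?invr_ge0 ?(ltW ths)// sumr_ge0// => i _; rewrite mulr0.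
  move=> ak0; rewrite mulrC ler_pdivlMr// mulrC -mulr_suml ler_wpM2r ?sqr_ge0//.
  rewrite -ltNge sqr_l2norm (bigID (mem J))/= [X in _ + X]big1 ?addr0 in k2.
    exact: ltW.
  move=> i iJ; case: (eqVneq (k i) 0) => [->|ki]; first by rewrite expr0n.
  by move: ak0; rewrite (aJ k i)// eqxx.
have -> : kappa / 2 = (theta * s%:R)^-1 * (s%:R * L).
  by rewrite /theta; field; rewrite !gt_eqF ?ltr0n//; lra.
apply: (@le_trans _ _ (\sum_(k <- K) ((if good k then l ^+ 2 else 0) +
    (theta * s%:R)^-1 * \sum_(i in J) (k i)%:~R ^+ 2 * a k ^+ 2))).
  by rewrite big_seq [leRHS]big_seq; apply: ler_sum => k; exact: pointwise.
rewrite big_split/= -mulr_sumr exchange_big/=; apply: lerD.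
  rewrite -big_mkcond/= big_fset_condE -/K1.
  have -> : \sum_(i <- K1) l ^+ 2 = (#|` K1|)%:R * l ^+ 2.
    by rewrite big_const_seq count_predT iter_addr_0 mulr_natl.
  by rewrite ler_wpM2r ?sqr_ge0// ler_nat.
rewrite ler_wpM2l ?invr_ge0 ?(ltW ths)//.
apply: (@le_trans _ _ (\sum_(i in J) L)).
  apply: ler_sum => i _; rewrite -lee_fin; apply: le_trans (smooth i).
  exact: sum_fset_le_esum.
by rewrite sumr_const -[leLHS]mulr_natl ler_wpM2r ?ler_nat// ltW.
Qed.

End sparse_coefficients.

End large_coefficient.

(** * Moment generating function of one observation *)

Section law.
Context {dT : measure_display} {T : measurableType dT} {R : realType}.
Context {d' : measure_display} {T' : measurableType d'}.
Variables (P : probability T R) (PX : probability T' R) (X : T -> T').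
Hypothesis mX : measurable_fun setT X.
Hypothesis lawX : forall B, measurable B -> P (X @^-1` B) = PX B.
Local Open Scope ereal_scope.

Lemma ge0_integral_law (h : T' -> \bar R) : measurable_fun setT h ->
  (forall x, 0 <= h x) -> \int[P]_w h (X w) = \int[PX]_x h x.
Proof.
move=> mh h0; transitivity (\int[pushforward P X]_x h x).
  by rewrite ge0_integral_pushforward.
by apply: eq_measure_integral => B mB _; exact: lawX.
Qed.

Lemma integral_law (h : T' -> \bar R) : measurable_fun setT h ->
  P.-integrable setT (h \o X) -> \int[P]_w h (X w) = \int[PX]_x h x.
Proof.
move=> mh ih; transitivity (\int[pushforward P X]_x h x).
  by rewrite integral_pushforward.
by apply: eq_measure_integral => B mB _; exact: lawX.
Qed.

End law.

Section one_observation.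
Context {dT : measure_display} {T : measurableType dT} {R : realType}.
Context {d' : measure_display} {T' : measurableType d'}.
Variables (P : probability T R) (PX : probability T' R).
Variables (X : T -> T') (e : T -> R) (a f : T' -> R) (D : set T') (A M L2 mean : R).
Hypothesis mX : measurable_fun setT X.
Hypothesis me : measurable_fun setT e.
Hypothesis ma : measurable_fun setT a.
Hypothesis mf : measurable_fun setT f.
Hypothesis mD : measurable D.
Hypothesis lawX : forall B, measurable B -> P (X @^-1` B) = PX B.
Hypothesis PXD : PX D = 1%E.
Hypothesis He : cond_subgaussian P e X.
Hypothesis aA : forall x, D x -> `|a x| <= A.
Hypothesis fM : forall x, D x -> `|f x| <= M.
Hypothesis A0 : 0 <= A.
Hypothesis M0 : 0 <= M.
Hypothesis fL2 : (\int[PX]_x (f x ^+ 2)%:E <= (L2 ^+ 2)%:E)%E.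
Hypothesis meanE : (\int[PX]_x (a x * f x * \1_D x)%:E = mean%:E)%E.

(** The indicator turns bounds valid on [D], hence almost surely, into bounds valid everywhere. *)
Let u x := a x * f x * \1_D x.

Let mu : measurable_fun setT u.
Proof. by apply: measurable_funM; [exact: measurable_funM|exact: measurable_indic]. Qed.

Let uAM x : `|u x| <= A * M.
Proof.
rewrite /u indicE; have [|_] := boolP (x \in D); last by rewrite mulr0 normr0 mulr_ge0.
by rewrite inE mulr1 normrM => Dx; rewrite ler_pM// ?aA ?fM.
Qed.

Let u2 x : u x ^+ 2 <= A ^+ 2 * f x ^+ 2.
Proof.
rewrite /u indicE; have [|_] := boolP (x \in D); last first.
  by rewrite mulr0 expr0n mulr_ge0// sqr_ge0.
rewrite inE mulr1 exprMn => Dx; rewrite ler_wpM2r ?sqr_ge0//.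
by rewrite -[leLHS]real_normK ?num_real// lerXn2r ?nnegrE// aA.
Qed.

Let integrable_bounded (h : T' -> R) (B : R) : measurable_fun setT h ->
  (forall x, `|h x| <= B) -> P.-integrable setT (EFin \o (h \o X)).
Proof.
move=> mh hB; apply: measurable_bounded_integrable => //.
- by rewrite [X in (X < _)%E](@probability_setT _ _ _ P) ltry.
- exact: measurableT_comp.
- by exists B; split; [exact: num_real|move=> x Bx w _ /=; rewrite (le_trans (hB _))// ltW].
Qed.

(** The supremum A M only keeps t u within the range of the quadratic inequality; the exponent
    involves the second moment of u, at most A^2 L2^2. The last step is 1 + x <= e^x. *)
Let mgf_bounded (t : R) : `|t| * (A * M) <= 3 / 2 ->
  (\int[P]_w (expR (t * u (X w)))%:E <= (expR (t * mean + t ^+ 2 * (A ^+ 2 * L2 ^+ 2)))%:E)%E.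
Proof.
move=> tAM.
have tu x : t * u x <= 3 / 2.
  apply: le_trans tAM; rewrite (le_trans (ler_norm _))// normrM ler_wpM2l//.
have mtu : measurable_fun setT (fun x => t * u x) by exact: measurable_funM.
have iu : P.-integrable setT (EFin \o (u \o X)) by exact: integrable_bounded uAM.
have iu2 : P.-integrable setT (EFin \o ((fun x => u x ^+ 2) \o X)).
  apply: (@integrable_bounded _ ((A * M) ^+ 2)); first exact: measurable_funX.
  by move=> x; rewrite normrX lerXn2r ?nnegrE// mulr_ge0.
have Eu : (\int[P]_w (u (X w))%:E = mean%:E)%E.
  by rewrite (integral_law mX lawX (h := EFin \o u))//; exact/measurable_EFinP.
have Eu2 : (\int[P]_w (u (X w) ^+ 2)%:E <= (A ^+ 2 * L2 ^+ 2)%:E)%E.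
  rewrite (ge0_integral_law mX lawX (h := fun x => (u x ^+ 2)%:E)); last 2 first.
  - by apply/measurable_EFinP; exact: measurable_funX.
  - by move=> x; rewrite lee_fin sqr_ge0.
  apply: (@le_trans _ _ (\int[PX]_x ((A ^+ 2)%:E * (f x ^+ 2)%:E))%E).
    apply: ge0_le_integral => //.
    - by move=> x _; rewrite lee_fin sqr_ge0.
    - by apply/measurable_EFinP; exact: measurable_funX.
    - by apply: emeasurable_funM => //; apply/measurable_EFinP; exact: measurable_funX.
    - by move=> x _; rewrite -EFinM lee_fin.
  rewrite ge0_integralZl_EFin ?sqr_ge0//; last 2 first.
  - by move=> x _; rewrite lee_fin sqr_ge0.
  - by apply/measurable_EFinP; exact: measurable_funX.
  by rewrite [leRHS]EFinM; apply: lee_wpmul2l => //; rewrite lee_fin sqr_ge0.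
apply: (@le_trans _ _ (\int[P]_w ((1 + t * u (X w)) + t ^+ 2 * u (X w) ^+ 2)%:E)%E).
  apply: ge0_le_integral => //.
  - apply/measurable_EFinP; apply: measurableT_comp => //.
    exact: (measurableT_comp mtu mX).
  - apply/measurable_EFinP; apply: measurable_funD.
      apply: measurable_funD => //; exact: (measurableT_comp mtu mX).
    apply: measurable_funM => //; apply: measurable_funX; exact: measurableT_comp.
  - by move=> w _; rewrite lee_fin -exprMn; exact: expR_le_quadratic.
under eq_integral do rewrite EFinD EFinM.
rewrite integralD//=; last 2 first.
- under eq_fun do rewrite EFinD EFinM.
  apply: integrableD => //; last exact: integrableZl.
  exact: finite_measure_integrable_cst.
- exact: integrableZl.
under eq_integral do rewrite EFinD EFinM.
rewrite integralD//=; last 2 first.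
- exact: finite_measure_integrable_cst.
- exact: integrableZl.
rewrite integral_cst// mul1e [X in (X + _ + _)%E](_ : _ = 1%E); last exact: (probability_setT P).
rewrite integralZl// Eu.
rewrite integralZl//.
apply: (@le_trans _ _ (1 + t%:E * mean%:E + (t ^+ 2)%:E * (A ^+ 2 * L2 ^+ 2)%:E)%E).
  by apply: leeD2l; apply: lee_wpmul2l => //; rewrite lee_fin sqr_ge0.
by rewrite -!EFinM -!EFinD lee_fin -addrA expR_ge1Dx.
Qed.

(** On [D] the exponent is t u(X) plus the noise times a coefficient of size at most |t| sigma A.
    The noise therefore costs a factor e^(t^2 sigma^2 A^2 / 2) whatever the design, and
    [mgf_bounded] handles the rest. *)
Lemma mgf_one_observation (sigma t : R) : 0 <= sigma -> `|t| * (A * M) <= 3 / 2 ->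
  (\int[P]_w (expR (t * (a (X w) * (f (X w) + sigma * e w))))%:E <=
   (expR (t * mean + t ^+ 2 * A ^+ 2 * (sigma ^+ 2 / 2 + L2 ^+ 2)))%:E)%E.
Proof.
move=> sg0 tAM.
pose s x := t * sigma * (a x * \1_D x).
pose G x := expR (t * u x).
have ms : measurable_fun setT s.
  by apply: measurable_funM => //; apply: measurable_funM => //; exact: measurable_indic.
have mG : measurable_fun setT G.
  by apply: measurableT_comp => //; exact: measurable_funM.
have sc x : `|s x| <= `|t| * sigma * A.
  rewrite /s !normrM (ger0_norm sg0) ler_wpM2l ?mulr_ge0// indicE.
  by have [|_] := boolP (x \in D); rewrite ?inE ?normr1 ?mulr1 ?normr0 ?mulr0//; exact: aA.
have -> : (\int[P]_w (expR (t * (a (X w) * (f (X w) + sigma * e w))))%:E =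
    \int[P]_w (G (X w) * expR (s (X w) * e w))%:E)%E.
  apply: ae_eq_integral => //.
  - apply/measurable_EFinP; apply: measurableT_comp => //; apply: measurable_funM => //.
    apply: measurable_funM; first exact: measurableT_comp.
    apply: measurable_funD; first exact: measurableT_comp.
    exact: measurable_funM.
  - apply/measurable_EFinP; apply: measurable_funM; first exact: measurableT_comp.
    apply: measurableT_comp => //; apply: measurable_funM => //.
    exact: measurableT_comp.
  - have mXD : measurable (X @^-1` D) by rewrite -[Y in measurable Y]setTI; exact: mX.
    exists (~` (X @^-1` D)); split; first exact: measurableC.
    + transitivity (1 - P (X @^-1` D))%E; first exact: probability_setC.
      by rewrite lawX// PXD subee.
    + move=> w; apply: contra_not => /= Dw _; congr EFin.
      rewrite /G /s /u indicE mem_set//= -expRD !mulr1; congr expR; ring.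
apply: le_trans (mgf_random_coef me mX He mG ms _ sc) _.
  by move=> x; exact: expR_ge0.
apply: le_trans (lee_wpmul2l _ (mgf_bounded tAM)) _.
  by rewrite lee_fin expR_ge0.
rewrite -EFinM lee_fin -expRD ler_expR.
rewrite !exprMn real_normK ?num_real//.
by rewrite le_eqVlt; apply/orP; left; apply/eqP; field.
Qed.

End one_observation.

(** * Chernoff bound *)

Section deviation.
Context {dT : measure_display} {T : measurableType dT} {R : realType}.
Variable P : probability T R.
Variable n : nat.
Context {d' : measure_display} {T' : measurableType d'}.
Variables (V : 'I_n -> T -> T') (z : T' -> R).
Hypothesis mV : forall i, measurable_fun setT (V i).
Hypothesis mz : measurable_fun setT z.
Hypothesis indepV : mutually_independent P V.

Let S w := \sum_(i < n) z (V i w).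

Let mS : measurable_fun setT S.
Proof. by apply: measurable_sum => i; exact: measurableT_comp. Qed.

Lemma measurable_ge (h : T -> R) (c : R) : measurable_fun setT h ->
  measurable [set w | c <= h w].
Proof.
move=> mh; rewrite (_ : [set _ | _] = h @^-1` `[c, +oo[%classic).
  by rewrite -[X in measurable X]setTI; exact: mh.
by apply/seteqP; split=> w /=; rewrite in_itv/= andbT.
Qed.

Lemma chernoff_independent (t c : R) :
  (P [set w | (c <= t * S w)%R] <=
   (expR (- c))%:E * \prod_(i < n) \int[P]_w (expR (t * z (V i w)))%:E)%E.
Proof.
have mtS : measurable_fun setT (fun w => t * S w) by exact: measurable_funM.
have mA := measurable_ge c mtS.
apply: (@le_trans _ _ ((expR (- c))%:E * \int[P]_w (expR (t * S w))%:E)%E).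
  have <- : (\int[P]_w (\1_[set w | (c <= t * S w)%R] w)%:E = P [set w | (c <= t * S w)%R])%E.
    by rewrite integral_indic// setIT.
  rewrite -ge0_integralZl_EFin ?expR_ge0//; last first.
    by apply/measurable_EFinP; exact: measurableT_comp.
  apply: ge0_le_integral => //.
  - exact/measurable_EFinP.
  - apply: emeasurable_funM => //; apply/measurable_EFinP; exact: measurableT_comp.
  - move=> w _; rewrite -EFinM lee_fin -expRD indicE.
    have [|_] := boolP (w \in _); last by rewrite expR_ge0.
    by rewrite inE /= => h; rewrite -[leLHS]expR0 ler_expR; lra.
apply: lee_wpmul2l; first by rewrite lee_fin expR_ge0.
under eq_integral do rewrite /S mulr_sumr expR_sum.
apply: (indep_integral_prod_le mV indepV (h := fun _ x => expR (t * z x))).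
- by move=> i; apply: measurableT_comp => //; exact: measurable_funM.
- by move=> i x; exact: expR_ge0.
Qed.

Lemma mean_deviation_le (mean v t lambda : R) : 0 < t -> (0 < n)%N ->
  (forall i, (\int[P]_w (expR (t * z (V i w)))%:E <=
     (expR (t * mean + t ^+ 2 * v))%:E)%E) ->
  (forall i, (\int[P]_w (expR (- t * z (V i w)))%:E <=
     (expR (- t * mean + t ^+ 2 * v))%:E)%E) ->
  (P [set w | (lambda <= `|n%:R^-1 * S w - mean|)%R] <=
    (2 * expR (n%:R * (t ^+ 2 * v - t * lambda)))%:E)%E.
Proof.
move=> t0 n0 mgfp mgfn.
have nR0 : 0 < n%:R :> R by rewrite ltr0n.
(* Taken at [t] for the upper tail and at [- t] for the lower one. *)
have tail (u : R) : u ^+ 2 = t ^+ 2 ->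
    (forall i, (\int[P]_w (expR (u * z (V i w)))%:E <=
     (expR (u * mean + t ^+ 2 * v))%:E)%E) ->
    (P [set w | (n%:R * (t * lambda + u * mean) <= u * S w)%R] <=
     (expR (n%:R * (t ^+ 2 * v - t * lambda)))%:E)%E.
  move=> u2 mgf; apply: le_trans (chernoff_independent _ _) _.
  apply: (@le_trans _ _ ((expR (- (n%:R * (t * lambda + u * mean))))%:E *
      \prod_(i < n) (expR (u * mean + t ^+ 2 * v))%:E)%E).
    apply: lee_wpmul2l; first by rewrite lee_fin expR_ge0.
    apply: lee_prod => i _; rewrite mgf andbT.
    by apply: integral_ge0 => w _; rewrite lee_fin expR_ge0.
  rewrite prodEFin prodr_const card_ord -expRM_natl -EFinM lee_fin -expRD ler_expR.
  by rewrite le_eqVlt; apply/orP; left; apply/eqP; ring.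
have mtS (u : R) : measurable_fun setT (fun w => u * S w) by exact: measurable_funM.
apply: (@le_trans _ _ (P ([set w | (n%:R * (t * lambda + t * mean) <= t * S w)%R] `|`
    [set w | (n%:R * (t * lambda + - t * mean) <= - t * S w)%R]))%E).
  apply: le_measure; rewrite ?inE.
  - apply: measurable_ge; apply: measurableT_comp => //.
    by apply: measurable_funB => //; exact: mtS.
  - by apply: measurableU; exact: measurable_ge.
  - move=> w /=; rewrite ler_normr => /orP[h|h].
      left; have := ler_wpM2l (ltW (mulr_gt0 nR0 t0)) h.
      rewrite (_ : n%:R * t * (n%:R^-1 * S w - mean) = t * S w - n%:R * t * mean); first lra.
      by field; exact: lt0r_neq0.
    right; have := ler_wpM2l (ltW (mulr_gt0 nR0 t0)) h.
    rewrite (_ : n%:R * t * - (n%:R^-1 * S w - mean) = - t * S w + n%:R * t * mean); first lra.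
    by field; exact: lt0r_neq0.
apply: (le_trans (measureU2 P (measurable_ge _ (mtS t)) (measurable_ge _ (mtS (- t))))).
rewrite (_ : 2 = 1 + 1)// mulrDl mul1r EFinD; apply: leeD; apply: tail => //.
by rewrite sqrrN.
Qed.

End deviation.

(** * The design density *)

Lemma measurable_inv (R : realType) : measurable_fun setT (@GRing.inv R).
Proof.
rewrite -(setUv [set (0 : R)]); apply/measurable_funU => //; first exact: measurableC.
split; first exact: measurable_fun_set1.
apply: open_continuous_measurable_fun.
  rewrite openC; exact/accessible_closed_set1/hausdorff_accessible/Rhausdorff.
by move=> x; rewrite inE /= => /eqP x0; exact: inv_continuous.
Qed.

Section design.
Variables (R : realType) (d : nat).
Variables (PX : probability (d.-tuple R) R) (f g : d.-tuple R -> R).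
Variables (gmin M L2 : R).
Hypothesis mf : measurable_fun setT f.
Hypothesis mg : measurable_fun setT g.
Hypothesis density : forall B : set (d.-tuple R), measurable B ->
  (PX B = \int[lebesgue_vec R d]_(x in B) (g x)%:E)%E.
Hypothesis hC2 : C2 gmin g.
Hypothesis hC3 : C3 PX M L2 f.
Hypothesis M0 : 0 <= M.

(** A set of full design probability on which both phi_k / g and [f] are bounded. *)
Definition regular_design : set (d.-tuple R) := @cube R d `&` [set x | `|f x| <= M].
Local Notation D := regular_design.

Lemma density_ge0 x : 0 <= g x.
Proof.
have [gm0 gout gin] := hC2; have [Cx|/gout->//] := pselect (@cube R d x).
exact: le_trans (ltW gm0) (gin x Cx).
Qed.

Let mfM : measurable [set x | `|f x| <= M].
Proof.
rewrite (_ : [set _ | _] = (fun x => `|f x|) @^-1` `]-oo, M]%classic); last first.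
  by apply/seteqP; split=> y /=; rewrite in_itv.
by rewrite -[X in measurable X]setTI; apply: measurableT_comp.
Qed.

Lemma measurable_regular_design : measurable D.
Proof. by apply: measurableI => //; exact: (@measurable_cube R d). Qed.

Lemma probability_regular_design : PX D = 1%E.
Proof.
have [gm0 gout gin] := hC2; have [fb _] := hC3.
have mC := @measurable_cube R d.
have C0 : PX (~` (@cube R d)) = 0%E.
  rewrite density//; last exact: measurableC.
  by apply: integral0_eq => x Cx; rewrite gout.
have F0 : PX (~` [set x | `|f x| <= M]) = 0%E.
  transitivity (1 - PX [set x | (`|f x| <= M)%R])%E; first exact: probability_setC.
  by rewrite fb subee.
have D0 : PX (~` D) = 0%E.
  apply/eqP; rewrite eq_le measure_ge0 andbT /regular_design setCI.
  apply: le_trans (measureU2 PX (measurableC mC) (measurableC mfM)) _.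
  by rewrite [X in (X + _)%E](_ : _ = 0%E) ?[X in (_ + X)%E](_ : _ = 0%E) ?adde0.
have := probability_setC PX measurable_regular_design.
by rewrite D0 => /eqP; rewrite eq_sym sube_eq ?add0e// => /eqP.
Qed.

(** The exceptional set N inside the cube has design probability 0, and gmin times its Lebesgue
    measure is at most that probability because g >= gmin there. *)
Lemma ae_bounded_on_cube : {ae lebesgue_vec R d, forall x, cube x -> `|f x| <= M}.
Proof.
have [gm0 gout gin] := hC2.
have mC := @measurable_cube R d.
have mN : measurable (@cube R d `\` D).
  by apply: measurableD => //; exact: measurable_regular_design.
exists (@cube R d `\` D); split => //; last first.
  move=> x /not_implyP[Cx fx]; split => // -[_]; exact: fx.
have PXN : PX (@cube R d `\` D) = 0%E.
  apply/eqP; rewrite eq_le measure_ge0 andbT.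
  have <- : PX (~` D) = 0%E.
    transitivity (1 - PX D)%E; first exact: (probability_setC PX measurable_regular_design).
    by rewrite probability_regular_design subee.
  by apply: le_measure; rewrite ?inE; [|exact: measurableC measurable_regular_design|move=> x []].
apply/eqP; rewrite eq_le measure_ge0 andbT.
have : (gmin%:E * lebesgue_vec R d (@cube R d `\` D) <= 0)%E.
  rewrite -PXN density// -integral_cst//; apply: ge0_le_integral => //.
  - by move=> x _; rewrite lee_fin ltW.

  - exact/measurable_funTS/measurable_EFinP.
  - by move=> x [Cx _]; rewrite lee_fin gin.
by rewrite pmule_rle0// lte_fin.
Qed.

Lemma normr_weight_le k (x : d.-tuple R) : cube x -> `|fourier k x / g x| <= Num.sqrt 2 / gmin.
Proof.
have [gm0 gout gin] := hC2 => Cx; have gx := gin x Cx.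
rewrite normrM normfV (ger0_norm (density_ge0 x)) ler_pM ?invr_ge0 ?density_ge0//.
  exact: normr_fourier_le.
by rewrite lef_pV2// posrE// (lt_le_trans gm0).
Qed.

(** This is the unbiasedness of the empirical coefficients: the weight 1 / g cancels the design
    density on the cube, which differs from [D] by a Lebesgue-null set. *)
Lemma integral_importance_weight k :
  (\int[PX]_x (fourier k x / g x * f x * \1_D x)%:E = (fourier_coef f k)%:E)%E.
Proof.
have [gm0 gout gin] := hC2.
have mC := @measurable_cube R d.
have mD := measurable_regular_design.
have mphi := @measurable_fourier R d k.
have mi : measurable_fun setT (\1_D : _ -> R) by exact: measurable_indic.
pose A : R := Num.sqrt 2 / gmin.
have mW : measurable_fun setT (fun x => fourier k x / g x * f x * \1_D x).
  apply: measurable_funM => //; apply: measurable_funM => //; apply: measurable_funM => //.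
  by apply: measurableT_comp => //; exact: measurable_inv.
have intW : PX.-integrable setT (EFin \o (fun x => fourier k x / g x * f x * \1_D x)).
  apply: measurable_bounded_integrable => //.
    by rewrite [X in (X < _)%E](probability_setT PX) ltry.
  exists (A * M); split; [exact: num_real|move=> y Ay x _ /=; apply: le_trans (ltW Ay)].
  rewrite indicE; have [|_] := boolP (x \in D); last first.
    by rewrite mulr0 normr0 mulr_ge0// divr_ge0 ?sqrtr_ge0// ltW.
  by rewrite inE mulr1 normrM => -[Cx fx]; rewrite ler_pM// normr_weight_le.
suff E : (\int[PX]_x (fourier k x / g x * f x * \1_D x)%:E =
    \int[lebesgue_vec R d]_(x in @cube R d) (f x * fourier k x)%:E)%E.
  by rewrite /fourier_coef /Rintegral -E fineK//; exact: integrable_fin_num intW.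
rewrite (integral_density mg density intW).
transitivity (\int[lebesgue_vec R d]_x (f x * fourier k x * \1_(@cube R d) x)%:E)%E.
  apply: ae_eq_integral => //.
  - by apply: emeasurable_funM; exact/measurable_EFinP.
  - apply/measurable_EFinP; apply: measurable_funM; first exact: measurable_funM.
    exact: measurable_indic.
  - apply: filterS ae_bounded_on_cube => x fx _; rewrite -EFinM; congr EFin.
    rewrite !indicE; have [|xC] := boolP (x \in @cube R d); last first.
      rewrite memNset ?mulr0 ?mul0r// => -[Cx _].
      by move: xC; rewrite notin_setE.
    rewrite inE => Cx; rewrite mem_set; last by split => //; exact: fx.
    by field; rewrite gt_eqF// (lt_le_trans gm0)// gin.
rewrite [RHS]integral_mkcond; apply: eq_integral => x _.
by rewrite epatch_indic /= -EFinM.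
Qed.

End design.

(** * The estimator *)

Section selection.
Variables (R : realType) (n d : nat) (g : d.-tuple R -> R).

Lemma finite_freq_set (m : R) (s : nat) (j : 'I_d) : finite_set (freq_set m s j).
Proof. by apply: (sub_finite_set _ (@finite_l2ball R d m)) => k []. Qed.

(** Since l >= 0, the initial value 0 of the maximum never exceeds l, so an empty index set is no
    exception. *)
Lemma lt_bigmax_normP (I : eqType) (r : seq I) (F : I -> R) (l : R) : 0 <= l ->
  l < \big[Num.max/0]_(k <- r) `|F k| <-> exists2 k, k \in r & l < `|F k|.
Proof.
move=> l0; split=> [lmax|[k kr lk]]; last first.
  by apply: (lt_le_trans lk); exact: (@le_bigmax_seq _ _ _ r 0 k xpredT (fun k => `|F k|) kr).
apply: contrapT => /forall2NP noK; move: lmax; apply/negP; rewrite -leNgt.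
rewrite big_seq; apply: bigmax_le => // k kr.
by have [|/negP] := noK k => //; rewrite -leNgt.
Qed.

Lemma in_JhatP (x : 'I_n -> d.-tuple R) (y : 'I_n -> R) (s : nat) (m l : R) (j : 'I_d) :
  0 <= l ->
  j \in Jhat g x y s m l <-> exists2 k, freq_set m s j k & l < `|emp_coef g x y k|.
Proof.
move=> l0; rewrite inE; split.
  move=> /(lt_bigmax_normP _ _ l0)[k + lk]; rewrite in_fset_set ?inE; last exact: finite_freq_set.
  by move=> kS; exists k.
move=> [k kS lk]; apply/(lt_bigmax_normP _ _ l0); exists k => //.
by rewrite in_fset_set ?inE//; exact: finite_freq_set.
Qed.

Lemma Jhat_correct (x : 'I_n -> d.-tuple R) (y : 'I_n -> R) (a : freq d -> R) (s : nat)
    (m l : R) (J : {set 'I_d}) :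
  0 <= l ->
  (forall (k : freq d) i, i \notin J -> k i != 0 -> a k = 0) ->
  (forall j, j \in J -> exists k, freq_set m s j k /\ 2 * l < `|a k|) ->
  (forall k, l2norm R k <= m -> (l0norm k <= s)%N -> `|emp_coef g x y k - a k| < l) ->
  Jhat g x y s m l = J.
Proof.
move=> l0 aJ large close; apply/setP => j; apply/idP/idP => [|jJ].
  move=> /(in_JhatP _ _ _ _ _ l0)[k [km ks kj]]; apply: contraPT => jJ.
  by have := close k km ks; rewrite (aJ k j)// subr0 => /ltW; rewrite leNgt => /negP.
apply/(in_JhatP _ _ _ _ _ l0); have [k [kS lk]] := large j jJ; exists k => //.
have [km ks _] := kS; have := close k km ks.
by have := ler_distD (emp_coef g x y k) (a k) 0; rewrite !subr0 distrC; lra.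
Qed.

Context {dT : measure_display} {T : measurableType dT}.
Variables (X : 'I_n -> T -> d.-tuple R) (Y : 'I_n -> T -> R).
Hypothesis mX : forall i, measurable_fun setT (X i).
Hypothesis mY : forall i, measurable_fun setT (Y i).
Hypothesis mg : measurable_fun setT g.

Lemma measurable_weighted_response k :
  measurable_fun setT (fun p : d.-tuple R * R => fourier k p.1 / g p.1 * p.2).
Proof.
apply: measurable_funM; last exact: measurable_snd.
apply: measurable_funM.
  by apply: measurableT_comp; [exact: measurable_fourier|exact: measurable_fst].
apply: measurableT_comp; first exact: measurable_inv.
by apply: measurableT_comp => //; exact: measurable_fst.
Qed.

Lemma measurable_emp_coef k :
  measurable_fun setT (fun w => emp_coef g (X^~ w) (Y^~ w) k).
Proof.
apply: measurable_funM => //; apply: measurable_sum => i.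
have mXY : measurable_fun setT (fun w => (X i w, Y i w)) by exact: measurable_fun_pair.
exact: (measurableT_comp (measurable_weighted_response k) mXY).
Qed.

(** Needed for subadditivity of [P]. The error event is a finite union over coordinates of
    disagreements with [J], and selecting a coordinate is a finite union over frequencies. *)
Lemma measurable_Jhat_neq (J : {set 'I_d}) (s : nat) (m l : R) : 0 <= l ->
  measurable [set w | Jhat g (X^~ w) (Y^~ w) s m l != J].
Proof.
move=> l0.
pose B j := [set w | j \in Jhat g (X^~ w) (Y^~ w) s m l].
have mB j : measurable (B j).
  rewrite (_ : B j = \bigcup_(k in freq_set m s j)
      [set w | l < `|emp_coef g (X^~ w) (Y^~ w) k|]); last first.
    apply/seteqP; split=> w /= => [/(in_JhatP _ _ _ _ _ l0)[k kS lk]|[k kS lk]].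
      by exists k.
    by apply/(in_JhatP _ _ _ _ _ l0); exists k.
  apply: fin_bigcup_measurable; first exact: finite_freq_set.
  move=> k _; rewrite (_ : [set _ | _] =
      (fun w => `|emp_coef g (X^~ w) (Y^~ w) k|) @^-1` `]l, +oo[%classic).
    rewrite -[Z in measurable Z]setTI; apply: measurableT_comp => //.
    exact: measurable_emp_coef.
  by apply/seteqP; split=> w /=; rewrite in_itv/= andbT.
have BE j w : (w \in B j) = (j \in Jhat g (X^~ w) (Y^~ w) s m l).
  by apply/idP/idP => h; [move: h; rewrite inE|rewrite inE].
have mB' j (b : bool) : measurable [set w | (w \in B j) != b].
  case: b.
    rewrite (_ : [set _ | _] = ~` B j); first exact: measurableC.
    by apply/seteqP; split=> w /=; case: (boolP (w \in B j)) => //; rewrite ?inE ?notin_setE.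
  rewrite (_ : [set _ | _] = B j)//.
  by apply/seteqP; split=> w /=; case: (boolP (w \in B j)) => //; rewrite ?inE ?notin_setE.
rewrite (_ : [set _ | _] = \bigcup_(j in [set: 'I_d])
    [set w | (w \in B j) != (j \in J)]); last first.
  apply/seteqP; split=> w /=.
    move=> /eqP neq; apply: contrapT => /forall2NP h; apply: neq; apply/setP => j.
    rewrite -BE; apply/eqP; apply: contrapT => neqj.
    by have [|] := h j; apply => //=; apply/negP.
  move=> [j _ /= /eqP Bj]; apply/eqP => E; apply: Bj.
  by rewrite BE E.
by apply: fin_bigcup_measurable => // j _; exact: mB'.
Qed.

End selection.

(** * The theorem *)

Lemma sparse_indep_coord (R : realType) (d : nat) (f : d.-tuple R -> R) (J : {set 'I_d})
    (i : 'I_d) :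
  (exists fbar : #|J|.-tuple R -> R, forall x, f x = fbar (subvec J x)) -> i \notin J ->
  forall x y, (forall i', i' != i -> tnth x i' = tnth y i') -> f x = f y.
Proof.
move=> [fbar fE] iJ x y xy; rewrite !fE; congr fbar; apply/eq_from_tnth => a.
rewrite !tnth_mktuple xy//; apply: contraNneq iJ => <-; exact: enum_valP.
Qed.

Section emp_coef_deviation.
Context {dT : measure_display} {T : measurableType dT} {R : realType}.
Variables (P : probability T R) (n d : nat).
Variables (PX : probability (d.-tuple R) R) (f g : d.-tuple R -> R) (sigma : R).
Variables (X : 'I_n -> {RV P >-> d.-tuple R}) (Y eps : 'I_n -> {RV P >-> R}).
Variables (gmin M L2 : R).
Hypothesis sigma0 : 0 <= sigma.
Hypothesis hmodel : regression_model PX g f sigma X Y eps.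
Hypothesis M0 : 0 < M.
Hypothesis hC2 : C2 gmin g.
Hypothesis hC3 : C3 PX M L2 f.
Hypothesis hC4 : C4 X eps.

Lemma emp_coef_deviation (k : freq d) (t l : R) : (0 < n)%N -> 0 < t ->
  t * (Num.sqrt 2 / gmin * M) <= 3 / 2 ->
  (P [set w | (l <= `|emp_coef g (X^~ w) (Y^~ w) k - fourier_coef f k|)%R] <=
   (2 * expR (n%:R * (t ^+ 2 * ((Num.sqrt 2 / gmin) ^+ 2 * (sigma ^+ 2 / 2 + L2 ^+ 2))
      - t * l)))%:E)%E.
Proof.
move=> n0 t0 tM; have [indep _ YE _ law mf mg density] := hmodel.
have [gm0 _ _] := hC2; have [_ fL2] := hC3.
pose V i w : d.-tuple R * R := (X i w, Y i w).
pose z (p : d.-tuple R * R) := fourier k p.1 / g p.1 * p.2.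
have mV i : measurable_fun setT (V i) by exact: measurable_fun_pair.
have mz : measurable_fun setT z by exact: measurable_weighted_response.
have A0 : 0 <= Num.sqrt 2 / gmin by rewrite divr_ge0 ?sqrtr_ge0// ltW.
have mgf (u : R) i : `|u| = t -> (\int[P]_w (expR (u * z (V i w)))%:E <=
    (expR (u * fourier_coef f k +
      t ^+ 2 * ((Num.sqrt 2 / gmin) ^+ 2 * (sigma ^+ 2 / 2 + L2 ^+ 2))))%:E)%E.
  move=> ut; under eq_integral do rewrite /z /V /= YE.
  have uE : t ^+ 2 = u ^+ 2 by rewrite -ut real_normK ?num_real.
  rewrite mulrA uE.
  apply: (mgf_one_observation (PX := PX) (a := fun x => fourier k x / g x)
    (D := regular_design f M) (M := M)) => //.
  - apply: measurable_funM; first exact: measurable_fourier.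
    exact: (measurableT_comp (@measurable_inv R) mg).
  - exact: measurable_regular_design.
  - exact: law.
  - exact: (probability_regular_design mf density hC2 hC3).
  - by move=> x [Cx _]; exact: (normr_weight_le hC2).
  - by move=> x [].
  - exact: ltW.
  - exact: (integral_importance_weight mf mg density hC2 hC3 (ltW M0)).
  - by rewrite ut.
have := @mean_deviation_le _ _ _ P n _ _ V z mV mz indep (fourier_coef f k)
  ((Num.sqrt 2 / gmin) ^+ 2 * (sigma ^+ 2 / 2 + L2 ^+ 2)) t l t0 n0.
apply => i; first by apply: mgf; rewrite gtr0_norm.
by apply: mgf; rewrite normrN gtr0_norm.
Qed.

End emp_coef_deviation.

(** * Arithmetic of the union bound *)

Section numerics.
Variable R : realType.

(** Origin of the constant 24. With y = d / s, e^(2 lg) = 24^2 theta y^2 must dominate the product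
    of 2 e^2 theta y from the count, 8 y from the target and 2 from the two tails (2 <= 2^s as s >=
    1). This product is 32 e^2 theta y^2, and 24^2 = 18 * 32. *)
Lemma union_bound_le (s : nat) (theta y lg C : R) : (0 < s)%N -> 1 <= theta -> 0 < y ->
  expR lg = 24 * Num.sqrt theta * y ->
  C <= (expR 2 * (2 * theta * y)) ^+ s ->
  C * (2 * expR (- (2 * (s%:R * lg)))) <= (8 * y) ^- s.
Proof.
move=> s0 th1 y0 lgE CX.
have th0 : 0 < theta by exact: lt_le_trans th1.
pose c : R := theta * y ^+ 2.
have c0 : 0 < c by rewrite mulr_gt0// exprn_gt0.
pose a := expR lg ^+ 2.
have aE : a = 18 * (32 * c).
  rewrite /a lgE (exprMn 2 (24 * Num.sqrt theta)) (exprMn 2 24) sqr_sqrtr ?(ltW th0)//.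
  by rewrite /c; ring.
have -> : expR (- (2 * (s%:R * lg))) = (a ^+ s)^-1.
  by rewrite expRN mulrCA expRM_natl (expRM_natl 2 lg).
have a0 : 0 < a ^+ s by rewrite exprn_gt0// exprn_gt0// expR_gt0.
have b0 : 0 < (8 * y) ^+ s by rewrite exprn_gt0// mulr_gt0.
pose x := expR 2 * (2 * theta * y).
have x0 : 0 <= x by rewrite mulr_ge0 ?expR_ge0// ltW// !mulr_gt0.
rewrite mulrA ler_pdivrMr// [leRHS]mulrC ler_pdivlMr// -mulrA.
have two : 2 <= 2 ^+ s :> R by rewrite -[leLHS]expr1 ler_weXn2l ?ler1n.
apply: (@le_trans _ _ (x ^+ s * (2 ^+ s * (8 * y) ^+ s))).
  apply: (@le_trans _ _ (x ^+ s * (2 * (8 * y) ^+ s))).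
    by rewrite ler_wpM2r// mulr_ge0// ltW.
  by rewrite ler_wpM2l ?exprn_ge0// ler_pM2r.
rewrite -(exprMn s 2 (8 * y)) -(exprMn s x).
have -> : x * (2 * (8 * y)) = expR 2 * (32 * c) by rewrite /x /c; ring.
rewrite aE; apply: lerXn2r; rewrite ?nnegrE.
- by rewrite mulr_ge0 ?expR_ge0// mulr_ge0// ltW.
- by rewrite mulr_ge0// mulr_ge0// ltW.
- by rewrite ler_wpM2r ?expR2_le18// mulr_ge0// ltW.
Qed.

End numerics.

Theorem theorem3 (R : realType) (dT : measure_display) (T : measurableType dT)
  (P : probability T R) (n d dstar : nat)
  (hn : (1 <= n)%N) (hdstar : (1 <= dstar)%N) (hd : (dstar <= d)%N)
  (PX : probability (d.-tuple R) R) (f g : d.-tuple R -> R) (sigma0 sigma : R)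
  (X : 'I_n -> {RV P >-> d.-tuple R}) (Y eps : 'I_n -> {RV P >-> R})
  (hsigma0 : 0 <= sigma0) (hsigma : sigma0 <= sigma)
  (hmodel : regression_model PX g f sigma0 X Y eps)
  (kappa L gmin Linf L2 : R) (J : {set 'I_d})
  (hkappa : 0 < kappa) (hLinf : 0 < Linf) (hL2 : 0 <= L2)
  (hC1 : C1 kappa L dstar f J) (hL : J = finset.set0 -> kappa <= L)
  (hC2 : C2 gmin g) (hC3 : C3 PX Linf L2 f) (hC4 : C4 X eps) :
  let theta := 2 * L / kappa in
  let lg := ln (24 * Num.sqrt theta * d%:R / dstar%:R) in
  let m := Num.sqrt (theta * dstar%:R) in
  let lambda := 4 * (sigma + L2) * Num.sqrt (dstar%:R * lg / (n%:R * gmin ^+ 2)) in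
  dstar%:R * lg / n%:R <= L2 ^+ 2 / Linf ^+ 2 ->
  128 * (sigma + L2) ^+ 2 * dstar%:R * (lattice_count dstar theta)%:R * lg
    / (n%:R * gmin ^+ 2) < kappa ->
  (P [set w | Jhat g (fun i => X i w) (fun i => Y i w) dstar m lambda != J]
     <= ((8 * d%:R / dstar%:R) ^- dstar)%:E)%E.
Proof.
move=> theta lg m lambda h1 h2.
have [_ _ _ _ _ mf mg density] := hmodel.
have [gm0 _ _] := hC2; have [smooth Js sparse rel] := hC1.
have sR0 : 0 < dstar%:R :> R by rewrite ltr0n.
have nR0 : 0 < n%:R :> R by rewrite ltr0n.
(* Relevance gives this as soon as [J] has an element; [hL] covers empty [J]. It yields theta >= 2,
   hence lg > 0 and the condition theta >= 1 of the counting bound. *)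
have kL : kappa <= L.
  have [/hL//|[j jJ]] := set_0Vmem J.
  exact: (kappa_le_smoothness smooth (rel j jJ)).
have th2 : 2 <= theta by rewrite /theta ler_pdivlMr//; lra.
have th0 : 0 < theta by lra.
pose y : R := d%:R / dstar%:R.
have y1 : 1 <= y by rewrite /y ler_pdivlMr// mul1r ler_nat.
have sqth : 1 <= Num.sqrt theta by rewrite -[leLHS]sqrtr1 ler_sqrt//; lra.
have arg1 : 1 < 24 * Num.sqrt theta * d%:R / dstar%:R.
  by rewrite -mulrA -/y; nra.
have lg0 : 0 < lg by exact: ln_gt0.
have lgE : expR lg = 24 * Num.sqrt theta * y.
  by rewrite /lg lnK ?mulrA// posrE; lra.
pose r2 := dstar%:R * lg / n%:R.
have r20 : 0 < r2 by rewrite divr_gt0// mulr_gt0.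
(* The left side of [h1] is positive, so L2 cannot vanish; this makes S = sigma + L2 a legitimate
   denominator even without noise. *)
have L20 : 0 < L2.
  rewrite lt_neqAle hL2 andbT; apply/negP => /eqP E; move: h1.
  by rewrite -E expr0n mul0r leNgt r20.
pose r := Num.sqrt r2.
have rr : r ^+ 2 = r2 by rewrite sqr_sqrtr// ltW.
have r0 : 0 < r by rewrite sqrtr_gt0.
have sg0 : 0 <= sigma by lra.
pose S := sigma + L2.
have S0 : 0 < S by rewrite /S; lra.
have lamE : lambda = 4 * S * r / gmin.
  rewrite /lambda -/S -(mulrA (4 * S)); congr (_ * _).
  have -> : dstar%:R * lg / (n%:R * gmin ^+ 2) = r2 * (gmin^-1) ^+ 2.
    by rewrite /r2 exprVn invfM mulrA.
  by rewrite sqrtrM ?(ltW r20)// sqrtr_sqr ger0_norm// invr_ge0 ltW.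
have rL : r * Linf <= L2.
  rewrite -ler_pdivlMr//.
  rewrite -[leRHS]ger0_norm; last by rewrite divr_ge0// ltW.
  by rewrite -sqrtr_sqr ler_wsqrtr// expr_div_n.
have lam0 : 0 <= lambda by rewrite lamE !mulr_ge0// ?invr_ge0 ltW.
have m2 : m ^+ 2 = theta * dstar%:R by rewrite sqr_sqrtr// mulr_ge0// ltW.
(* The minimizer of 2 t^2 S^2 / gmin^2 - t lambda. *)
pose t := gmin * r / S.
have t0 : 0 < t by rewrite divr_gt0// mulr_gt0.
have tM : t * (Num.sqrt 2 / gmin * Linf) <= 3 / 2.
  have -> : t * (Num.sqrt 2 / gmin * Linf) = Num.sqrt 2 * (r * Linf / S).
    by rewrite /t; field; rewrite !gt_eqF.
  have sq2 : Num.sqrt 2 <= 3 / 2 :> R.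
    have -> : 3 / 2 = Num.sqrt ((3 / 2) ^+ 2) :> R.
      by rewrite sqrtr_sqr ger0_norm//; lra.
    by rewrite ler_wsqrtr//; lra.
  have q0 : 0 <= r * Linf / S by rewrite divr_ge0 ?mulr_ge0// ltW.
  have q1 : r * Linf / S <= 1 by rewrite ler_pdivrMr// mul1r /S; lra.
  by rewrite -[leRHS]mulr1; apply: ler_pM => //; exact: sqrtr_ge0.
pose a := fourier_coef f.
have aJ (k : freq d) i : i \notin J -> k i != 0 -> a k = 0.
  move=> iJ; apply: (fourier_coef_indep_coord mf).
    exact: (ae_bounded_on_cube mf mg density hC2 hC3).
  exact: sparse_indep_coord sparse iJ.
have large j : j \in J -> exists k, freq_set m dstar j k /\ 2 * lambda < `|a k|.
  move=> jJ; apply: (exists_large_coef hkappa hdstar Js smooth (rel j jJ) jJ aJ).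
  (* Origin of 128: 2 N (2 lambda)^2 with lambda = 4 S r / gmin. *)
  apply: le_lt_trans h2; rewrite lamE -/theta le_eqVlt; apply/orP; left; apply/eqP.
  rewrite (_ : (2 * (4 * S * r / gmin)) ^+ 2 = 64 * S ^+ 2 * r2 / gmin ^+ 2); last first.
    by rewrite -rr; field; rewrite gt_eqF.
  by rewrite /r2 /S; field; rewrite !gt_eqF.
pose Kset := [set k : freq d | l2norm R k <= m /\ (l0norm k <= dstar)%N].
have finK : finite_set Kset.
  by apply: (sub_finite_set _ (@finite_l2ball R d m)) => k [].
pose dev k := [set w | lambda <= `|emp_coef g (X^~ w) (Y^~ w) k - a k|].
have mX i : measurable_fun setT (X i) by [].
have mY i : measurable_fun setT (Y i) by [].
have mdev k : measurable (dev k).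
  apply: measurable_ge; apply: measurableT_comp => //; apply: measurable_funB => //.
  exact: (measurable_emp_coef mX mY mg).
have sub : [set w | Jhat g (X^~ w) (Y^~ w) dstar m lambda != J] `<=` \bigcup_(k in Kset) dev k.
  move=> w /= /eqP neq; apply: contrapT => /forall2NP close; apply: neq.
  apply: (Jhat_correct lam0 aJ large) => k km ks.
  have [[]//|] := close k.
  by move/negP; rewrite -ltNge.
have mE := measurable_Jhat_neq mX mY mg J dstar m lam0.
apply: le_trans (content_sub_fsum P finK (fun k _ => mdev k) mE sub) _.
rewrite fsbig_finite//=.
apply: (@le_trans _ _ (\sum_(k <- fset_set Kset) (2 * expR (- (2 * (dstar%:R * lg))))%:E)%E).
  apply: lee_sum => k _.
  apply: le_trans (emp_coef_deviation hsigma0 hmodel hLinf hC2 hC3 hC4 k lambda hn t0 tM) _.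
  rewrite lee_fin ler_pM2l// ler_expR.
  (* The squared weight bound 2 / gmin^2 doubles sigma0^2 / 2 + L2^2. The deviation involves the
     true noise level [sigma0], the threshold its upper estimate [sigma]; they meet here. *)
  have sgS : sigma0 ^+ 2 + 2 * L2 ^+ 2 <= 2 * S ^+ 2 by rewrite /S; nra.
  have -> : t ^+ 2 * ((Num.sqrt 2 / gmin) ^+ 2 * (sigma0 ^+ 2 / 2 + L2 ^+ 2)) =
      r2 * ((sigma0 ^+ 2 + 2 * L2 ^+ 2) / S ^+ 2).
    rewrite (expr_div_n (Num.sqrt 2)) (sqr_sqrtr (_ : 0 <= 2))// -rr /t; field.
    by rewrite !gt_eqF.
  have -> : t * lambda = 4 * r2 by rewrite lamE /t -rr; field; rewrite !gt_eqF.
  have -> : - (2 * (dstar%:R * lg)) = n%:R * (r2 * 2 - 4 * r2).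
    by rewrite /r2; field; rewrite gt_eqF.
  rewrite ler_pM2l// lerB// ler_pM2l// ler_pdivrMr//; last by rewrite exprn_gt0.
rewrite sumEFin lee_fin big_const_seq count_predT iter_addr_0 -[leLHS]mulr_natl.
rewrite -[8 * d%:R / _]mulrA -/y.
apply: (union_bound_le hdstar _ _ lgE); [lra|lra|].
rewrite /y (mulrA (2 * theta)); apply: card_sparse_ball_le; first by rewrite hdstar.
  lra.
move=> k; rewrite in_fset_set// inE => -[km ks]; split => //.
by rewrite -m2 lerXn2r ?nnegrE ?sqrtr_ge0.
Qed.
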